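(* Given $p_0>0$, there exist universal constants of approximation (depending only on $p_0$), such that for all $p\geqslant p_0$, separable abelian metric monoids $(\mathscr{G},1_{\mathscr{G}},d_{\mathscr{G}})$, and finite sequences $X_1,\dots,X_n$ of independent $\mathscr{G}$-valued random variables (for any $n\in\mathbb{N}$), \[ \mathbb{E}_\mu[U_n^p]^{1/p}\ \approx\ U_n^*(e^{-p}/4)+\mathbb{E}[\ell_X^p]^{1/p}\ \approx\ \left(U'_n(e^{-p}/8)\right)^*(e^{-p}/4)+\mathbb{E}[\ell_X^p]^{1/p}, \] where $U_n=\max_{1\leqslant i\leqslant n}d_{\mathscr{G}}(z_1,z_0S_i)$ with $S_i=X_1X_2\cdots X_i$ and with fixed elements $z_0,z_1\in\mathscr{G}$, and where $U'_n$ and $\ell_X$ are as defined in the context.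
   Context: A metric monoid is a monoid $(\mathscr{G},\cdot,1_{\mathscr{G}})$ equipped with a metric $d_{\mathscr{G}}:\mathscr{G}\times\mathscr{G}\to[0,\infty)$ that is translation-invariant: $d_{\mathscr{G}}(ac,bc)=d_{\mathscr{G}}(a,b)=d_{\mathscr{G}}(ca,cb)$ for all $a,b,c\in\mathscr{G}$. It is abelian if the operation is commutative, and separable if the metric space is separable. The $\mathscr{G}$-valued random variables are defined on a probability space $(\Omega,\mathscr{A},\mu)$ and are Borel measurable; $\mathbb{P}_\mu,\mathbb{E}_\mu$ denote probability and expectation with respect to $\mu$. Fix $z_0,z_1\in\mathscr{G}$. Given $X_1,\dots,X_n$, set, for $1\leqslant j\leqslant n$, \[ S_j:=X_1X_2\cdots X_j,\qquad U_j:=\max_{1\leqslant i\leqslant j}d_{\mathscr{G}}(z_1,z_0S_i). \] The function $\ell_X=\ell_{(X_i)}:\mathbb{R}\to[0,\infty]$ is defined by \[ \ell_X(t):=\inf\left\{y>0:\ \sum_{i=1}^n\mathbb{P}_\mu\left(d_{\mathscr{G}}(z_0,z_0X_i)>y\right)\leqslant t\right\}\ \text{ if }t\in[0,1],\qquad \ell_X(t):=0\ \text{ otherwise.} \] (By translation-invariance, $d_{\mathscr{G}}(z_0,z_0X_i)=d_{\mathscr{G}}(1_{\mathscr{G}},X_i)$.) It is regarded as a random variable on $[0,1]$ with Lebesgue measure, so $\mathbb{E}[\ell_X^p]=\int_0^1\ell_X(t)^p\,dt$. For $t\geqslant0$, the truncation $X(t)$ of a $\mathscr{G}$-valued random variable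 $X$ is $X(t):=1_{\mathscr{G}}$ if $d_{\mathscr{G}}(1_{\mathscr{G}},X)>t$, and $X(t):=X$ otherwise. For $r\in(0,1)$, \[ U'_n(r):=\max_{1\leqslant k\leqslant n}d_{\mathscr{G}}\left(1_{\mathscr{G}},\ \prod_{i=1}^kX_i(\ell_X(r))\right). \] For a $[0,\infty)$-valued random variable $Z$ on $\Omega$, its decreasing rearrangement is $Z^*(t):=\sup\{y\in[0,\infty):\mathbb{P}_\mu(Z>y)>t\}$ for $t\in[0,1]$. Two families of quantities $P(t)$ and $Q(t)$ are comparable, written $P(t)\approx Q(t)$, if there exist constants $c_1,c_2>0$ (the constants of approximation) such that $c_1^{-1}P(t)\leqslant Q(t)\leqslant c_2P(t)$ uniformly over all $t$. Here the constants depend only on $p_0$, and the comparison is uniform over all $p\geqslant p_0$, all such $\mathscr{G}$, and all such finite sequences $X_1,\dots,X_n$.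
   Formalization: The upper bound of U_n^*(e^{-p}/4)+E[ℓ_X^p]^{1/p} by E[U_n^p]^{1/p}, and by the truncated expression, is asserted only for z_0=z_1, since both fail for z_0≠z_1 (in ℝ, n=1, z_0=0, z_1=1: X_1=1, resp. X_1=0); the other two inequalities hold for all z_0, z_1. *)

(* Defs.v *)
From HB Require Import structures.
From mathcomp Require Import all_boot all_order all_algebra.
From mathcomp Require Import all_classical all_reals all_analysis.

Set Implicit Arguments.
Unset Strict Implicit.
Unset Printing Implicit Defensive.
Import Order.TTheory GRing.Theory Num.Theory.
Import numFieldNormedType.Exports.

Local Open Scope classical_set_scope.
Local Open Scope ring_scope.

HB.mixin Record Metric_isTranslationInvariant (R : numDomainType) G
    of Metric R G & Monoid G := {
  mdist_mulr : forall a b c : G, mdist (a * c)%g (b * c)%g = mdist a b :> R ;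
  mdist_mull : forall a b c : G, mdist (c * a)%g (c * b)%g = mdist a b :> R
}.

#[short(type="metricMonoidType")]
HB.structure Definition MetricMonoid (R : numDomainType) :=
  { G of Metric R G & Monoid G & Metric_isTranslationInvariant R G }.

Definition separable (T : topologicalType) :=
  exists2 D : set T, countable D & dense D.

(* [<<s @open G >>] is the Borel sigma-algebra of [G]. The library's
   [measurable_fun] unfolds to this, but would require [G] to be pointed. *)
Definition borel_measurable d (Omega : measurableType d) (G : topologicalType)
    (Y : Omega -> G) :=
  forall B : set G, <<s @open G >> B -> measurable (Y @^-1` B).

Definition mutually_independent d (Omega : measurableType d) (R : realType)
    (P : probability Omega R) (G : topologicalType) (n : nat)
    (X : 'I_n -> Omega -> G) :=
  forall (J : {set 'I_n}) (B : 'I_n -> set G),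
    (forall i, i \in J -> <<s @open G >> (B i)) ->
    P (\bigcap_(i in [set` J]) (X i @^-1` B i)) =
      (\prod_(i in J) P (X i @^-1` B i))%E.

(* The supremum is taken in [0, +oo], where that of the empty set is 0. *)
Definition rearrangement d (Omega : measurableType d) (R : realType)
    (P : probability Omega R) (Z : Omega -> R) (t : R) : \bar R :=
  maxe 0%E (ereal_sup [set y%:E | y in
    [set y : R | 0 <= y /\ (t%:E < P [set w | (y < Z w)%R])%E]]).

Section metric_monoid_sums.
Context d (Omega : measurableType d) (R : realType) (P : probability Omega R).
Context (G : metricMonoidType R) (n : nat).
Implicit Types (X : 'I_n -> Omega -> G) (z : G).

(* Indices start at 0: [partial_prod X j] is the product of the first [j.+1]
   variables. *)
Definition partial_prod X (j : 'I_n) (w : Omega) : G :=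
  (\prod_(i < n | (i <= j)%N) X i w)%g.

(* Distances are nonnegative, so for [0 < n] the unit 0 of [max] is harmless. *)
Definition max_dist z0 z1 X (w : Omega) : R :=
  \big[Num.max/0]_(j < n) mdist z1 (z0 * partial_prod X j w)%g.

Definition ell z0 X (t : R) : \bar R :=
  if 0 <= t <= 1 then
    ereal_inf [set y%:E | y in [set y : R | 0 < y /\
      (\sum_(i < n) P [set w | (y < mdist z0 (z0 * X i w)%g)%R] <= t%:E)%E]]
  else 0%E.

Definition truncation (t : \bar R) (x : G) : G :=
  if (t < (mdist 1%g x)%:E)%E then 1%g else x.

Definition max_dist_trunc z0 X (r : R) (w : Omega) : R :=
  \big[Num.max/0]_(k < n)
    mdist 1%g (partial_prod (fun i w => truncation (ell z0 X r) (X i w)) k w).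

End metric_monoid_sums.

Definition moment_root d (Omega : measurableType d) (R : realType)
    (P : probability Omega R) (Z : Omega -> R) (p : R) : \bar R :=
  ('E_P[fun w => (Z w `^ p)%R] `^ p^-1)%E.

Definition unit_moment_root (R : realType) (f : R -> \bar R) (p : R) : \bar R :=
  ((\int[lebesgue_measure]_(t in `[0%R, 1%R]) (f t `^ p)) `^ p^-1)%E.

(* Main.v *)
Require Import Defs.
From mathcomp Require Import all_boot all_order all_algebra.
From mathcomp Require Import all_classical all_reals all_analysis.
From mathcomp Require Import measurable_realfun ring lra.
Import Order.TTheory GRing.Theory Num.Theory.
Import numFieldNormedType.Exports.
Local Open Scope classical_set_scope.
Local Open Scope ring_scope.

(** Write [U] for the maximal distance, [M] for the largest step
    [max_i d(1, X_i)], [N(y)] for the sum of the [P (d(1, X_i) > y)], [m] for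
    [d(z0, z1)], [u] for the rearrangement of [U] at [exp(-p) / 4], and [l] for
    the [p]-th root of the integral of [ell ^ p].

    Everything rests on a Hoffmann-Jorgensen inequality with absolute
    constants: if [y >= m] then [P (U > 4y) <= P (U > y)^2 + P (M > y)]
    ([hoffmann_jorgensen]). The walk is stopped when it first gets further than
    [y] from [z1]; unless [M > y] it is then within [2y], so a later distance
    above [4y] forces an increment above [2y] of the remaining walk. That event
    is independent of the past and contained in [U > y], because an increment is
    at most the sum of the two distances at its ends.

    The function [ell] is the quantile function of [N], so the Lebesgue measure
    of [ell > y] is [min(1, N(y))], which independence makes comparable to
    [P (M > y)] ([max_step_le_ell_tail], [ell_tail_le_max_step]). Hence [ell] can
    replace [M] in all estimates of tails and moments. Moreover
    [ell(t) <= t^(-1/p) l], and for [t = exp(-p) / a] with [1 <= a <= 16] the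
    factor is at most [e 16^(1/p0)]: this is where all constants become uniform
    in [p >= p0] ([ell_quantile]).

    Upper bound of the moment. One application of the inequality is too weak for
    large [p], since [4^p] is not absorbed by [P (U > y) <= exp(-p) / 4].
    Applied twice it gives
    [P (U > 16y) <= P (U > y)^4 + 4 P (M > y)], where
    [16^p exp(-3p) <= 1] because [16 <= e^3]. The moments are then compared by
    integrating the tails ([good_lambda], [moment_max_dist_le]). The admissible
    levels [y] must dominate both [u] and [m]; the latter is at most
    [u + 16^(1/p0) l], because the first step has size at least [m - U]
    ([start_dist_le]).

    Lower bound of the moment, when [z0 = z1]. Markov's inequality bounds [u],
    and [M <= 2U] bounds [l].

    Truncation. The truncated and the original walk differ only if
    [M > ell(r)], which has probability at most [r = exp(-p) / 8]. One
    application of the Hoffmann-Jorgensen inequality leaves enough room in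
    [exp(-p) / 4] for this error, at the price of the factor [4] in the level
    ([rearrangement_le_trunc], [trunc_le_rearrangement]). *)

Set Implicit Arguments.
Unset Strict Implicit.
Unset Printing Implicit Defensive.

(** * Measurability from tails *)

Lemma measurable_fun_tails d (T : measurableType d) (R : realType) (f : T -> R) :
  (forall y, measurable [set w | y < f w]) -> measurable_fun setT f.
Proof.
move=> H; apply: (measurability _ (RGenOInfty.measurableE R)) => /= _ [_ [x ->] <-].
rewrite setTI (_ : _ @^-1` _ = [set w | x < f w])//.
by apply/seteqP; split => w /=; rewrite in_itv/= andbT.
Qed.

Lemma measurable_tail_set d (T : measurableType d) (R : realType) (f : T -> R) y :
  measurable_fun setT f -> measurable [set w | y < f w].
Proof.
move=> mf; rewrite -[X in measurable X]setTI (_ : [set w | _] = f @^-1` `]y, +oo[).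
  exact: mf.
by apply/seteqP; split => w /=; rewrite in_itv/= andbT.
Qed.

Lemma measurable_efun_tails d (T : measurableType d) (R : realType) (f : T -> \bar R) :
  (forall y : R, measurable [set w | (y%:E < f w)%E]) -> measurable_fun setT f.
Proof.
move=> H; apply: (measurability _ (ErealGenOInfty.measurableE R)) => /= _ [_ [x ->] <-].
rewrite setTI (_ : _ @^-1` _ = [set w | (x%:E < f w)%E])//.
by apply/seteqP; split => w /=; rewrite in_itv/= andbT.
Qed.

(** * Tails, moments and the good-lambda inequality *)

Section tails.
Local Open Scope ereal_scope.
Context (R : realType).
Notation leb := (@lebesgue_measure R).

Lemma measurable_subgraph d (T : measurableType d) (f : T -> \bar R) :
  measurable_fun setT f ->
  measurable [set q : T * measurableTypeR R | (0 <= q.2)%R /\ q.2%:E < f q.1].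
Proof.
move=> mf; rewrite (_ : [set q | _] =
  [set q : T * measurableTypeR R | (0 <= q.2)%R] `&` [set q | q.2%:E < f q.1]) //.
apply: measurableI.
  have : measurable_fun setT (fun q : T * measurableTypeR R => (0 <= q.2)%R).
    exact: measurable_fun_ler.
  by move=> /(_ measurableT [set true]); rewrite setTI; exact.
rewrite -[X in measurable X]setTI.
apply: emeasurable_fun_lt => //.
  exact: (measurableT_comp (@EFin_measurable _ _)).
exact: measurableT_comp.
Qed.

Lemma measurable_tail d (T : measurableType d)
    (mu : {sigma_finite_measure set T -> \bar R}) (f : T -> \bar R) :
  measurable_fun setT f ->
  measurable_fun (`[0%R, +oo[%classic : set R)
    (fun r : R => mu [set x | r%:E < f x]).
Proof.
move=> mf.
have mt := measurable_fun_ysection mu (measurable_subgraph mf).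
apply: eq_measurable_fun (measurable_funTS mt) => r.
rewrite inE/= in_itv/= andbT => r0; congr (mu _).
rewrite ysectionE; apply/seteqP; split => x /=; first by case.
by split.
Qed.

(** Both sides are the measure of the subgraph of [f] above [0]. Infinite
    values are allowed because [ell] may be infinite at [0]. *)
Lemma layer_cake d (T : measurableType d)
    (mu : {sigma_finite_measure set T -> \bar R}) (f : T -> \bar R) :
  measurable_fun setT f -> (forall x, 0 <= f x) ->
  \int[mu]_x f x = \int[leb]_(r in `[0%R, +oo[) mu [set x | r%:E < f x].
Proof.
move=> mf f0.
pose GR := measurableTypeR R.
pose A := [set q : T * GR | (0 <= q.2)%R /\ q.2%:E < f q.1].
have mA : measurable A by exact: measurable_subgraph.
have mh : measurable_fun setT (fun q : T * GR => (\1_A q : R)%:E).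
  by apply/measurable_EFinP/measurable_indic.
have := @fubini_tonelli _ _ T GR R mu leb (fun q : T * GR => (\1_A q : R)%:E) mh.
rewrite /fubini_F /fubini_G /=.
have h0 (q : T * GR) : 0 <= (\1_A q : R)%:E by rewrite lee_fin.
move=> /(_ h0) Fub.
have intsect d' (T' : measurableType d') (nu : {measure set T' -> \bar R})
    (B : set T') (g : T' -> R) :
    measurable B -> (forall x, g x = \1_B x) -> \int[nu]_x (g x)%:E = nu B.
  move=> mB gB; under eq_integral do rewrite gB.
  by rewrite integral_indic// setIT.
have mA1 x : measurable [set r : GR | A (x, r)].
  by have := measurable_xsection x mA; rewrite xsectionE.
have mA2 r : measurable [set x : T | A (x, r)].
  by have := measurable_ysection r mA; rewrite ysectionE.
transitivity (\int[mu]_x \int[leb]_r (\1_A (x, r) : R)%:E).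
  apply: eq_integral => x _.
  rewrite (intsect _ _ _ [set r | A (x, r)]) //; apply: esym.
  have := f0 x; case E : (f x) => [a| |] // a0.
    rewrite (_ : [set r | A (x, r)] = `[0%R, a[%classic).
      apply: (etrans (lebesgue_measure_itv `[0%R, a[)); rewrite /= lte_fin.
      move: a0; rewrite lee_fin le_eqVlt => /orP[/eqP <-|->].
        by rewrite ltxx.
      by rewrite sube0.
    by apply/seteqP; split => r; rewrite /A /= E lte_fin in_itv/= => /andP.
  rewrite (_ : [set r | A (x, r)] = `[0%R, +oo[%classic).
    by apply: (etrans (lebesgue_measure_itv `[0%R, +oo[)); rewrite /= ltry.
  by apply/seteqP; split => r; rewrite /A /= E in_itv/= andbT ?ltry // => -[].
rewrite Fub [RHS]integral_mkcond.
apply: eq_integral => r _.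
rewrite (intsect _ _ _ [set x | A (x, r)]) //.
rewrite patchE mem_setE in_itv/= andbT; case: ifPn => r0.
  by congr (mu _); apply/seteqP; split => x; rewrite /A/= ?r0; [case|].
rewrite (_ : [set x | _] = set0) ?measure0//.
by apply/seteqP; split => x //; rewrite /A/= (negbTE r0) => -[].
Qed.

Lemma poweR_tail d (T : measurableType d) (f : T -> \bar R) (p r : R) :
  (0 < p)%R -> (0 <= r)%R -> (forall x, 0 <= f x) ->
  [set x | r%:E < f x `^ p] = [set x | (r `^ p^-1)%R%:E < f x].
Proof.
move=> p0 r0 f0; apply/seteqP; split => x /=; have := f0 x.
  case: (f x) => [a| |]//; last by rewrite !ltry.
  rewrite poweR_EFin lee_fin !lte_fin => a0 ra.
  rewrite -[ltRHS](@powRr1 _ a) // -(@mulfV _ p) ?gt_eqF// powRrM.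
  by apply: gt0_ltr_powR; rewrite ?invr_gt0 ?nnegrE ?powR_ge0.
case: (f x) => [a| |]//; last by rewrite poweRyr ?gt_eqF// !ltry.
rewrite poweR_EFin lee_fin !lte_fin => a0 ra.
rewrite -[ltLHS](@powRr1 _ r) // -(@mulVf _ p) ?gt_eqF// powRrM.
by apply: gt0_ltr_powR; rewrite ?nnegrE ?powR_ge0.
Qed.

Lemma measurable_fun_poweR d (T : measurableType d) (f : T -> \bar R) (p : R) :
  measurable_fun setT f -> measurable_fun setT (fun x => f x `^ p).
Proof. by move=> mf; apply: (measurableT_comp (measurable_poweR p)). Qed.

(** Integrating the tail bound at the level [r = y ^ p]: the levels
    [r < v ^ p], where only [m1 <= 1] is known, contribute the term [v ^ p]. *)
Lemma moment_le_of_tails d1 d2 d3 (T1 : measurableType d1)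
    (T2 : measurableType d2) (T3 : measurableType d3)
    (m1 : {sigma_finite_measure set T1 -> \bar R})
    (m2 : {sigma_finite_measure set T2 -> \bar R})
    (m3 : {sigma_finite_measure set T3 -> \bar R})
    (f1 : T1 -> \bar R) (f2 : T2 -> \bar R) (f3 : T3 -> \bar R)
    (p v b c : R) :
  (0 < p)%R -> (0 <= v)%R -> (0 <= b)%R -> (0 <= c)%R ->
  measurable_fun setT f1 -> measurable_fun setT f2 -> measurable_fun setT f3 ->
  (forall x, 0 <= f1 x) -> (forall x, 0 <= f2 x) -> (forall x, 0 <= f3 x) ->
  (forall y : R, (0 <= y)%R -> m1 [set x | y%:E < f1 x] <= 1) ->
  (forall y : R, (v <= y)%R -> m1 [set x | y%:E < f1 x] <=
    b%:E * m2 [set x | y%:E < f2 x] + c%:E * m3 [set x | y%:E < f3 x]) ->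
  \int[m1]_x (f1 x `^ p) <= (v `^ p)%:E + b%:E * \int[m2]_x (f2 x `^ p)
    + c%:E * \int[m3]_x (f3 x `^ p).
Proof.
move=> p0 v0 b0 c0 mf1 mf2 mf3 f10 f20 f30 H1 H.
have mp1 := @measurable_fun_poweR _ _ _ p mf1.
have mp2 := @measurable_fun_poweR _ _ _ p mf2.
have mp3 := @measurable_fun_poweR _ _ _ p mf3.
rewrite !layer_cake//; do ?by move=> x; exact: poweR_ge0.
have mt1 := measurable_tail m1 mp1.
have mt2 := measurable_tail m2 mp2.
have mt3 := measurable_tail m3 mp3.
have vp0 : (0 <= v `^ p)%R by exact: powR_ge0.
have -> : (v `^ p)%:E = \int[leb]_(r in `[0%R, +oo[) (\1_(`[0%R, (v `^ p)%R[) r)%:E.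
  rewrite integral_indic// setIidl//; last first.
    by move=> x /=; rewrite !in_itv/= => /andP[->].
  apply: esym; apply: (etrans (lebesgue_measure_itv `[0%R, (v `^ p)%R[)).
  rewrite /= lte_fin.
  by move: vp0; rewrite le_eqVlt => /orP[/eqP<-|->]; rewrite ?ltxx ?sube0.
have mI : measurable_fun (`[0%R, +oo[%classic : set R)
    (fun r : R => (\1_(`[0%R, (v `^ p)%R[%classic) r : R)%:E).
  by apply/measurable_EFinP/measurable_indic.
have mbt2 : measurable_fun (`[0%R, +oo[%classic : set R)
    (fun r : R => b%:E * m2 [set x | r%:E < f2 x `^ p]).
  exact: measurable_funeM.
have mct3 : measurable_fun (`[0%R, +oo[%classic : set R)
    (fun r : R => c%:E * m3 [set x | r%:E < f3 x `^ p]).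
  exact: measurable_funeM.
rewrite -(ge0_integralZl leb _ mt2)// -(ge0_integralZl leb _ mt3)//.
rewrite -(ge0_integralD leb _ _ mI _ mbt2)//; last by move=> x _; rewrite mule_ge0.
  rewrite -(ge0_integralD leb _ _ _ _ mct3)//; first last.
  - by move=> x _; rewrite mule_ge0.
  - exact: emeasurable_funD.
  - by move=> x _; rewrite adde_ge0// ?mule_ge0// lee_fin.
apply: ge0_le_integral => //.
  by do ?apply: emeasurable_funD.
move=> r; rewrite /= in_itv/= andbT => r0.
rewrite !poweR_tail// indicE; case: (boolP (r \in _)).
  move=> _; apply: (@le_trans _ _ 1); first by rewrite H1// powR_ge0.
  by rewrite -addeA leeDl// adde_ge0// mule_ge0.
rewrite notin_setE/= in_itv/= r0/= => /negP; rewrite -leNgt => vr.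
rewrite add0e; apply: H.
rewrite -[leLHS](@powRr1 _ v) // -(@mulfV _ p) ?gt_eqF// powRrM.
by apply: ge0_ler_powR; rewrite ?invr_ge0 ?nnegrE ?powR_ge0 ?(ltW p0).
Qed.
End tails.

Section tails2.
Local Open Scope ereal_scope.
Context (R : realType).

Lemma cvg_tail_right d (T : measurableType d) (P : probability T R) (Z : T -> R) (y : R) :
  measurable_fun setT Z ->
  P [set w | (y + k.+1%:R^-1 < Z w)%R] @[k --> \oo] --> P [set w | (y < Z w)%R].
Proof.
move=> mZ.
have mS z := measurable_tail_set z mZ.
pose F (k : nat) := [set w | (y + k.+1%:R^-1 < Z w)%R].
have -> : [set w | (y < Z w)%R] = \bigcup_k F k.
  apply/seteqP; split => w /=.
    move=> yZ; have [k _ kP] : \forall k \near \oo, (k.+1%:R^-1 < Z w - y)%R.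
      by apply: near_infty_natSinv_lt (PosNum _); rewrite subr_gt0.
    by exists k => //=; rewrite /F/= -ltrBrDl; apply: kP => /=.
  by move=> [k _]; apply: lt_trans; rewrite ltrDl invr_gt0.
apply: nondecreasing_cvg_mu => //; first exact: bigcupT_measurable.
move=> m n mn; apply/subsetPset => w; rewrite /F/=; apply: le_lt_trans.
by rewrite lerD2l lef_pV2 ?posrE// ler_nat ltnS.
Qed.

Lemma tail_sum_right d (T : measurableType d) (P : probability T R) n
    (Z : 'I_n -> T -> R) (y t : R) :
  (forall i, measurable_fun setT (Z i)) ->
  (forall y', (y < y')%R -> \sum_(i < n) P [set w | (y' < Z i w)%R] <= t%:E) ->
  \sum_(i < n) P [set w | (y < Z i w)%R] <= t%:E.
Proof.
move=> mZ H.
have cv : \sum_(i < n) P [set w | (y + k.+1%:R^-1 < Z i w)%R] @[k --> \oo] -->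
    \sum_(i < n) P [set w | (y < Z i w)%R].
  apply: cvg_nnesum => i _; first by apply: nearW => k.
  exact: cvg_tail_right.
rewrite -(cvg_lim _ cv)//; apply: lime_le; first by apply/cvg_ex; eexists; exact: cv.
by apply: nearW => k; apply: H; rewrite ltrDl invr_gt0.
Qed.

Lemma tail_right d (T : measurableType d) (P : probability T R) (Z : T -> R) (y t : R) :
  measurable_fun setT Z ->
  (forall y', (y < y')%R -> P [set w | (y' < Z w)%R] <= t%:E) ->
  P [set w | (y < Z w)%R] <= t%:E.
Proof.
move=> mZ H; have := @tail_sum_right _ _ P 1 (fun=> Z) y t (fun=> mZ).
by rewrite big_ord1; apply => y' /H; rewrite big_ord1.
Qed.

(** The tails of [U / a] are compared with those of [U], so the [p]-th moment
    reproduces itself with the factor [a ^ p * b <= 1 / 2] and can be absorbed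
    in the left-hand side. Absorption needs a finite moment: it is done for
    [min(U, k)], and [k] then tends to infinity. *)
Lemma good_lambda d (T : measurableType d) (P : probability T R)
    d' (T' : measurableType d') (mu : {sigma_finite_measure set T' -> \bar R})
    (U : T -> R) (f : T' -> \bar R) (p v a b c : R) :
  (0 < p)%R -> (0 <= v)%R -> (1 <= a)%R -> (0 <= b)%R -> (0 <= c)%R ->
  (2 * (a `^ p * b) <= 1)%R ->
  measurable_fun setT U -> (forall x, 0 <= U x)%R ->
  measurable_fun setT f -> (forall x, 0 <= f x) ->
  (forall y : R, (v <= y)%R -> P [set x | (a * y < U x)%R] <=
    b%:E * P [set x | (y < U x)%R] + c%:E * mu [set x | y%:E < f x]) ->
  \int[P]_x (U x `^ p)%:E <=
    (2 * a `^ p)%:E * ((v `^ p)%:E + c%:E * \int[mu]_x (f x `^ p)).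
Proof.
move=> p0 v0 a1 b0 c0 ab mU U0 mf f0 H.
have a0 : (0 < a)%R by exact: lt_le_trans a1.
have ap0 : (0 < a `^ p)%R by exact: powR_gt0.
set W := (v `^ p)%:E + _.
have W0 : 0 <= W.
  rewrite adde_ge0// ?lee_fin ?powR_ge0// mule_ge0// integral_ge0// => x _.
  exact: poweR_ge0.
pose V (k : nat) (x : T) := Num.min (U x) k%:R.
have mV k : measurable_fun setT (V k).
  by apply: measurable_minr.
have V0 k x : (0 <= V k x)%R by rewrite le_min U0 ler0n.
have mVp k : measurable_fun setT (fun x => ((V k x) `^ p)%:E).
  apply/measurable_EFinP.
  exact: (measurableT_comp (measurable_powR p)).
have HV k : \int[P]_x (V k x `^ p)%:E <= (2 * a `^ p)%:E * W.
  have mVE : measurable_fun setT (fun x => (V k x)%:E) by exact/measurable_EFinP.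
  have mVa : measurable_fun setT (fun x => (V k x / a)%:E).
    by apply/measurable_EFinP; exact: measurable_funM.
  have := @moment_le_of_tails R _ _ _ T T T' P P mu
    (fun x => (V k x / a)%:E) (fun x => (V k x)%:E) f p v b c p0 v0 b0 c0
    mVa mVE mf _ _ f0.
  have Va0 x : 0 <= (V k x / a)%:E by rewrite lee_fin divr_ge0// ltW.
  move=> /(_ Va0) /(_ (fun x => V0 k x)).
  have H1 y : (0 <= y)%R -> P [set x | y%:E < (V k x / a)%:E] <= 1.
    by move=> y0; apply: probability_le1; rewrite -[X in measurable X]setTI;
       exact: emeasurable_fun_lt.
  move=> /(_ H1).
  have H2 y : (v <= y)%R -> P [set x | y%:E < (V k x / a)%:E] <=
      b%:E * P [set x | y%:E < (V k x)%:E] + c%:E * mu [set x | y%:E < f x].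
    move=> vy; have y0 := le_trans v0 vy.
    (* Truncation at k respects the hypothesis: the left-hand event is empty when
    k <= a y, and for y < k the events y < min(U, k) and y < U agree. *)
    have -> : [set x | y%:E < (V k x / a)%:E] =
        if (a * y < k%:R)%R then [set x | (a * y < U x)%R] else set0.
      apply/seteqP; split => x /=.
        rewrite lte_fin ltr_pdivlMr// mulrC lt_min => /andP[yU yk].
        by rewrite yk.
      case: ifP => //= yk yU.
      by rewrite lte_fin ltr_pdivlMr// mulrC lt_min yU.
    case: ifP => yk; last first.
      by rewrite measure0 adde_ge0// mule_ge0.
    apply: (le_trans (H _ vy)).
    rewrite leeD2r// lee_wpmul2l//.
    have yk' : (y < k%:R)%R by apply: le_lt_trans yk; rewrite ler_peMl.
    rewrite (_ : [set x | (y < U x)%R] = [set x | y%:E < (V k x)%:E])//.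
    by apply/seteqP; split => x /=; rewrite lte_fin lt_min yk' andbT.
  move=> /(_ H2).
  under eq_integral do rewrite poweR_EFin powRM// ?invr_ge0 ?ltW// mulrC EFinM.
  rewrite ge0_integralZl//; last 2 first.
    by move=> x _; rewrite lee_fin powR_ge0.
    by rewrite lee_fin powR_ge0.
  under [X in _ <= _ + _ * X + _]eq_integral do rewrite poweR_EFin.
  set I := \int[P]_x _.
  have I0 : 0 <= I by apply: integral_ge0 => x _; rewrite lee_fin powR_ge0.
  have If : I <= ((k%:R : R) `^ p)%:E.
    apply: (@le_trans _ _ (\int[P]_x (cst ((k%:R : R) `^ p)%:E x))).
      apply: ge0_le_integral => //.
        by move=> x _; rewrite lee_fin powR_ge0.
      by move=> x _; rewrite lee_fin ge0_ler_powR// ?nnegrE ?(ltW p0)// ge_min lexx orbT.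
    by rewrite integral_cst// -[leRHS]mule1 lee_wpmul2l ?lee_fin ?powR_ge0 ?probability_le1.
  rewrite addeAC -/W.
  have aV : (a^-1 `^ p = (a `^ p)^-1)%R.
    by rewrite -powR_inv1 ?ltW// -powRrM mulN1r powRN.
  rewrite aV.
  case: I I0 If => [i| |]//; rewrite ?leye_eq// !lee_fin => i0 _.
  case: (W) W0 => [w| |]// w0; last first.
    by rewrite gt0_muley ?leey// lte_fin mulr_gt0.
  rewrite -!EFinM -EFinD !lee_fin mulrC ler_pdivrMr// => Hi.
  nra.
have -> : \int[P]_x (U x `^ p)%:E =
    limn (fun k => \int[P]_x (V k x `^ p)%:E).
  rewrite -monotone_convergence//; first last.
  - move=> x _ m n mn; rewrite lee_fin ge0_ler_powR// ?nnegrE ?(ltW p0)//.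
    by rewrite le_min ge_min lexx/= ge_min ler_nat mn orbT.
  - by move=> k x _; rewrite lee_fin powR_ge0.
  apply: eq_integral => x _; apply/esym/cvg_lim => //.
  apply: cvg_near_cst.
  have [k _ kP] : \forall k \near \oo, (U x <= k%:R)%R.
    exact: nbhs_infty_ger.
  by exists k => // m /= /kP Um; rewrite /V (min_idPl Um).
apply: lime_le; last exact: nearW.
apply: ereal_nondecreasing_is_cvgn => m n mn; apply: ge0_le_integral => //.
  by move=> x _; rewrite lee_fin powR_ge0.
move=> x _; rewrite lee_fin ge0_ler_powR// ?nnegrE ?(ltW p0)//.
by rewrite le_min ge_min lexx/= ge_min ler_nat mn orbT.
Qed.
End tails2.

(** * Independence of disjoint blocks of variables *)

Section sigma_algebra_lemmas.
Context {T : Type} {S : set (set T)} (hS : sigma_algebra setT S).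

Lemma sigma_setC A : S A -> S (~` A).
Proof. by case: hS => _ + _ => /[apply]; rewrite setTD. Qed.

Lemma sigma_set0 : S set0. Proof. by case: hS. Qed.

Lemma sigma_setT : S setT. Proof. by rewrite -setC0; apply: sigma_setC; exact: sigma_set0. Qed.

Lemma sigma_bigcup_countable (I : Type) (D : set I) (F : I -> set T) :
  countable D -> (forall i, D i -> S (F i)) -> S (\bigcup_(i in D) F i).
Proof.
move=> /countable_injP[g ginj] SF.
have -> : \bigcup_(i in D) F i =
    \bigcup_k \bigcup_(i in [set i | D i /\ g i = k]) F i.
  apply/seteqP; split => x /=.
    by move=> [i Di Fx]; exists (g i) => //; exists i.
  by move=> [k _ [i [Di _] Fx]]; exists i.
case: hS => _ _; apply => k.
have [[i [Di gi]]|nk] := pselect (exists i, D i /\ g i = k).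
  rewrite (_ : \bigcup_(_ in _) _ = F i); first exact: SF.
  apply/seteqP; split => x /=; last by exists i.
  move=> [j [Dj gj]]; rewrite (ginj j i) ?inE//; by rewrite gj gi.
rewrite (_ : \bigcup_(_ in _) _ = set0); first exact: sigma_set0.
by apply/seteqP; split => x //= [i h]; exfalso; apply: nk; exists i.
Qed.

Lemma sigma_bigcup_fin (I : finType) (D : set I) (F : I -> set T) :
  (forall i, D i -> S (F i)) -> S (\bigcup_(i in D) F i).
Proof.
by apply: sigma_bigcup_countable; apply: finite_set_countable; exact: finite_finset.
Qed.

Lemma sigma_bigcap_fin (I : finType) (D : set I) (F : I -> set T) :
  (forall i, D i -> S (F i)) -> S (\bigcap_(i in D) F i).
Proof.
move=> SF; rewrite -[X in S X]setCK setC_bigcap; apply: sigma_setC.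
by apply: sigma_bigcup_fin => i /SF/sigma_setC.
Qed.

Lemma sigma_setI A B : S A -> S B -> S (A `&` B).
Proof.
move=> SA SB; rewrite (_ : A `&` B = \bigcap_(b : bool) (if b then A else B)).
  by apply: sigma_bigcap_fin => -[].
apply/seteqP; split => x /=; first by case=> ? ? [].
by move=> h; split; [exact: (h true)|exact: (h false)].
Qed.

Lemma sigma_setU A B : S A -> S B -> S (A `|` B).
Proof.
move=> SA SB; rewrite -[X in S X]setCK setCU; apply: sigma_setC.
by apply: sigma_setI; exact: sigma_setC.
Qed.

End sigma_algebra_lemmas.

(** Measurability with respect to a family of events that need not be the
    canonical sigma-algebra of the domain: it will be generated by a block of
    the variables. *)
Definition adapted (T : Type) (S : set (set T)) (G : topologicalType)
    (Y : T -> G) :=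
  forall B : set G, <<s @open G >> B -> S (Y @^-1` B).

Section adapted.
Context {T : Type} {S : set (set T)} (hS : sigma_algebra setT S).

Lemma adapted_open (G : topologicalType) (Y : T -> G) :
  (forall B, open B -> S (Y @^-1` B)) -> adapted S Y.
Proof.
move=> H; apply: (@smallest_sub _ _ _ [set B | S (Y @^-1` B)]) => //.
split => /=.
- by rewrite preimage_set0; exact: sigma_set0.
- by move=> A SA; rewrite setTD preimage_setC; exact: sigma_setC.
- by move=> F SF; rewrite preimage_bigcup; apply: sigma_bigcup_countable.
Qed.

Lemma adapted_cst (G : topologicalType) (a : G) : adapted S (fun=> a).
Proof.
move=> B _; rewrite preimage_cst; case: ifP => _; [exact: sigma_setT|exact: sigma_set0].
Qed.

Context (R : realType) (G : metricMonoidType R).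

Lemma open_mdist_gt (z : G) (y : R) : open [set x | y < mdist z x].
Proof.
rewrite openE => x /= yx; apply/nbhs_ballP; exists (mdist z x - y) => /=.
  by rewrite subr_gt0.
move=> x'; rewrite ballEmdist/= => h.
have := metric_triangle z x' x; rewrite (metric_sym x' x); lra.
Qed.

Lemma adapted_mdist_gt (z : G) (y : R) (Y : T -> G) :
  adapted S Y -> S [set w | y < mdist z (Y w)].
Proof.
move=> aY; apply: (aY [set x | y < mdist z x]).
by apply: sub_sigma_algebra; exact: open_mdist_gt.
Qed.

(** Separability writes the event that the product lies in an open set as a
    countable union of rectangles: pairs of balls of the same radius [1 / (k + 1)]
    centred in the countable dense set, whose product lies in the open set.
    Translation invariance makes multiplication 1-Lipschitz in each variable,
    so radii below a quarter of the available room suffice. *)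
Lemma adapted_mul (Y Z : T -> G) : separable G ->
  adapted S Y -> adapted S Z -> adapted S (fun w => (Y w * Z w)%g).
Proof.
move=> [D cD dD] aY aZ; apply: adapted_open => O oO.
pose F (k : nat) (a b : G) : set T :=
  if `[< forall x y, ball a k.+1%:R^-1 x -> ball b k.+1%:R^-1 y -> O (x * y)%g >]
  then Y @^-1` ball a k.+1%:R^-1 `&` Z @^-1` ball b k.+1%:R^-1 else set0.
have -> : (fun w => (Y w * Z w)%g) @^-1` O =
    \bigcup_k \bigcup_(a in D) \bigcup_(b in D) F k a b.
  apply/seteqP; split => w /=.
    move=> Ow; have := oO; rewrite openE => /(_ _ Ow) /nbhs_ballP[e /= e0 eO].
    have [k _ kP] : \forall k \near \oo, (k.+1%:R^-1 < e / 4).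
      by apply: near_infty_natSinv_lt (PosNum _); rewrite divr_gt0.
    have {}kP : k.+1%:R^-1 < e / 4 by apply: kP => /=.
    have k0 : 0 < k.+1%:R^-1 :> R by rewrite invr_gt0.
    have dex (x : G) : exists2 a, D a & ball a k.+1%:R^-1 x.
      have := dD (ball x k.+1%:R^-1)°; case.
      - by exists x; exact: nbhsx_ballx.
      - exact: open_interior.
      - move=> a [/interior_subset xa Da]; exists a => //; exact: ball_sym.
    have [a Da aY'] := dex (Y w); have [b Db bZ] := dex (Z w).
    exists k => //; exists a => //; exists b => //; rewrite /F.
    case: asboolP => //; case => x y ax yb; apply: eO.
    move: ax yb aY' bZ; rewrite !ballEmdist/= => ax yb aY' bZ.
    have := metric_triangle (Y w * Z w)%g (x * Z w)%g (x * y)%g.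
    rewrite mdist_mulr mdist_mull => h.
    have := metric_triangle (Y w) a x; have := metric_triangle (Z w) b y.
    rewrite (metric_sym (Y w) a) (metric_sym (Z w) b).
    move: h ax yb aY' bZ kP. set dl := _^-1. lra.
  move=> [k _ [a Da [b Db]]]; rewrite /F; case: asboolP => // H [/= ? ?].
  exact: H.
have ob (a : G) (k : nat) : <<s @open G >> (ball a k.+1%:R^-1).
  apply: sub_sigma_algebra; rewrite openE => x; rewrite ballEmdist/= => ax.
  apply/nbhs_ballP; exists (k.+1%:R^-1 - mdist a x) => /=.
    by rewrite subr_gt0.
  move=> x'; rewrite !ballEmdist/= => h.
  have := metric_triangle a x x'; move: h ax; set e := _^-1; lra.
apply: (sigma_bigcup_countable hS) => // k _.
apply: (sigma_bigcup_countable hS) => // a _.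
apply: (sigma_bigcup_countable hS) => // b _.
rewrite /F; case: ifP => _; last exact: sigma_set0.
by apply: (sigma_setI hS); [exact: aY|exact: aZ].
Qed.

Lemma adapted_prod (Y : nat -> T -> G) (a b : nat) : separable G ->
  (forall i, (a <= i < b)%N -> adapted S (Y i)) ->
  adapted S (fun w => \prod_(a <= i < b) Y i w)%g.
Proof.
move=> sG; elim: b => [|b IH] H.
  by under eq_fun do rewrite big_geq//; exact: adapted_cst.
have [ab|ab] := leqP a b; last first.
  by under eq_fun do rewrite big_geq//; exact: adapted_cst.
under eq_fun do rewrite big_nat_recr//=.
apply: adapted_mul => //; last by apply: H; rewrite ab/=.
by apply: IH => i /andP[ai ib]; apply: H; rewrite ai ltnS ltnW.
Qed.

Lemma adapted_truncation (t : \bar R) (Y : T -> G) :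
  adapted S Y -> adapted S (fun w => truncation t (Y w)).
Proof.
move=> aY; pose C := [set x : G | (t < (mdist 1%g x)%:E)%E].
have bC : <<s @open G >> C.
  apply: sub_sigma_algebra; rewrite /C; case: (t) => [r| |].
  - under eq_set do rewrite lte_fin; exact: open_mdist_gt.
  - by rewrite (_ : [set _ | _] = set0); [exact: open0|apply/seteqP; split].
  - rewrite (_ : [set _ | _] = setT); first exact: openT.
    by apply/seteqP; split => // x _ /=; rewrite ltNyr.
move=> B bB.
have -> : (fun w => truncation t (Y w)) @^-1` B =
  (Y @^-1` C `&` (fun=> 1%g) @^-1` B) `|` (~` (Y @^-1` C) `&` Y @^-1` B).
  apply/seteqP; split => w; rewrite /truncation/C/=; case: ifP => c.
  - by left.
  - by right.
  - by case=> -[].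
  - by case=> -[].
apply: (sigma_setU hS); apply: (sigma_setI hS); [exact: aY|exact: adapted_cst| |exact: aY].
by apply: (sigma_setC hS); exact: aY.
Qed.

End adapted.

Section independence.
Context d (T : measurableType d) (R : realType) (P : probability T R).

(** The events independent of [C] form a Dynkin system. *)
Lemma independent_generated (C : set T) (G : set (set T)) :
  measurable C -> setI_closed G -> G `<=` measurable ->
  (forall A, G A -> P (A `&` C) = P A * P C)%E ->
  forall A, <<s G >> A -> measurable A /\ P (A `&` C) = (P A * P C)%E.
Proof.
move=> mC GI Gm GC A; rewrite -setI_closed_g_dynkin_g_sigma_algebra//.
apply: (@smallest_sub _ dynkin _
  [set A | measurable A /\ P (A `&` C) = (P A * P C)%E]); last first.
  by move=> B GB /=; split; [exact: Gm|exact: GC].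
have fC : P C \is a fin_num by exact: fin_num_measure.
split => /=.
- by split => //; rewrite setTI probability_setT mul1e.
- move=> B [mB hB]; split; first exact: measurableC.
  have -> : P (~` B `&` C) = (P C - P (B `&` C))%E.
    rewrite (setIC B C) [X in P X]setIC -setDE measureD//; first by rewrite ltey_eq fC.
  rewrite hB probability_setC//.
  rewrite muleBl ?mul1e//.
- move=> F tF mF; split; first by apply: bigcupT_measurable => k; case: (mF k).
  rewrite setI_bigcupl measure_bigcup//; last 2 first.
    by move=> i _; apply: measurableI => //; case: (mF i).
    by apply: trivIset_setIr.
  rewrite measure_bigcup//; last by move=> i _; case: (mF i).
  rewrite -(fineK fC) [RHS]muleC -nneseriesZl//.
  apply: eq_eseriesr => i _; rewrite fineK// muleC; by case: (mF i).
Qed.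

Context (G : topologicalType) (n : nat) (X : 'I_n -> T -> G).
Hypothesis mX : forall i, borel_measurable (X i).
Hypothesis iX : mutually_independent P X.

(** A pi-system generating the sigma-algebra of the variables in the block [J]. *)
Definition cylinder (J : {set 'I_n}) : set (set T) :=
  [set A | exists2 B : 'I_n -> set G, (forall i, <<s @open G >> (B i)) &
    A = \bigcap_(i in [set` J]) X i @^-1` B i].

Lemma cylinder_measurable J : cylinder J `<=` measurable.
Proof.
move=> A [B mB ->]; apply: (sigma_bigcap_fin (sigma_algebra_measurable T)) => i _.
exact: mX.
Qed.

Lemma cylinderI J : setI_closed (cylinder J).
Proof.
move=> _ _ [B mB ->] [B' mB' ->]; exists (fun i => B i `&` B' i).
  by move=> i; apply: (sigma_setI (smallest_sigma_algebra _ _)).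
by rewrite -bigcapI.
Qed.

Lemma adapted_cylinder (J : {set 'I_n}) i : i \in J -> adapted <<s cylinder J >> (X i).
Proof.
move=> iJ B mB; apply: sub_sigma_algebra.
exists (fun j => if j == i then B else setT).
  by move=> j; case: ifP => // _; apply: (sigma_setT (smallest_sigma_algebra _ _)).
apply/seteqP; split => w /=.
  by move=> Bw j _ /=; case: eqP => // ->.
by move=> /(_ i iJ) /=; rewrite eqxx.
Qed.

Lemma cylinder_independent (J K : {set 'I_n}) A B : (forall i, i \in J -> i \notin K) ->
  cylinder J A -> cylinder K B -> P (A `&` B) = (P A * P B)%E.
Proof.
move=> JK [B1 mB1 ->] [B2 mB2 ->].
pose B' i := if i \in J then B1 i else B2 i.
have mB' i : <<s @open G >> (B' i) by rewrite /B'; case: ifP.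
have e1 : \bigcap_(i in [set` J]) X i @^-1` B1 i = \bigcap_(i in [set` J]) X i @^-1` B' i.
  by apply: eq_bigcapr => i /= iJ; rewrite /B' iJ.
have e2 : \bigcap_(i in [set` K]) X i @^-1` B2 i = \bigcap_(i in [set` K]) X i @^-1` B' i.
  apply: eq_bigcapr => i /= iK; rewrite /B' ifF//.
  by apply/negP => /JK; rewrite iK.
rewrite e1 e2 -bigcap_setU.
rewrite (_ : [set` J] `|` [set` K] = [set` J :|: K]%SET); last first.
  by apply/seteqP; split => i /=; rewrite inE => /orP.
rewrite !iX// -bigU//=; last first.
  by rewrite disjoint_subset; apply/fintype.subsetP => i /JK; rewrite inE.
by apply: eq_bigl => i; rewrite !inE.
Qed.

Lemma block_independent (J K : {set 'I_n}) A B : (forall i, i \in J -> i \notin K) ->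
  <<s cylinder J >> A -> <<s cylinder K >> B ->
  [/\ measurable A, measurable B & P (A `&` B) = (P A * P B)%E].
Proof.
move=> JK sA sB.
have step C : cylinder K C -> P (A `&` C) = (P A * P C)%E.
  move=> KC; have [] // := independent_generated (cylinder_measurable KC)
    (@cylinderI J) (@cylinder_measurable J) _ sA.
  by move=> A' JA'; exact: cylinder_independent JA' KC.
have [mA _] : measurable A /\ P (A `&` setT) = (P A * P setT)%E.
  apply: (independent_generated _ (@cylinderI J) (@cylinder_measurable J) _ sA) => //.
  by move=> A' _; rewrite setIT probability_setT mule1.
have [mB hB] := independent_generated mA (@cylinderI K) (@cylinder_measurable K)
  (fun C KC => etrans (congr1 P (setIC C A)) (etrans (step C KC) (muleC _ _))) sB.
by split => //; rewrite setIC hB muleC.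
Qed.

End independence.

(** * The Hoffmann-Jorgensen inequality *)

Section walk.
Context d (Omega : measurableType d) (R : realType) (G : metricMonoidType R) (n : nat).
Implicit Types (X : 'I_n -> Omega -> G) (z : G).

(** Extending the steps by [1] beyond [n] makes products over intervals of natural
    numbers available, which [big_cat_nat] splits. *)
Definition step X (i : nat) (w : Omega) : G :=
  if insub i is Some j then X j w else 1%g.

Definition block_prod X (a b : nat) (w : Omega) : G :=
  (\prod_(a <= i < b) step X i w)%g.

Definition walk_dist z0 z1 X (k : nat) (w : Omega) : R :=
  mdist z1 (z0 * block_prod X 0 k w)%g.

Definition max_step X (w : Omega) : R :=
  \big[Num.max/0]_(i < n) mdist 1%g (X i w).

Lemma step_ord X (i : 'I_n) : step X i = X i.
Proof. by apply/funext => w; rewrite /step valK. Qed.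

Lemma partial_prodE X (j : 'I_n) w : partial_prod X j w = block_prod X 0 j.+1 w.
Proof.
rewrite /block_prod (@big_nat_widen _ _ _ 0 j.+1 n) ?ltn_ord// big_mkord.
by apply: eq_big => // i _; rewrite step_ord.
Qed.

Lemma walk_dist0 z0 z1 X w : walk_dist z0 z1 X 0 w = mdist z1 z0.
Proof. by rewrite /walk_dist /block_prod big_geq// mulg1. Qed.

(** Left invariance: the distance between two positions of the walk depends
    only on the steps between them. *)
Lemma block_prod_mdist z0 X j k w : (j <= k)%N ->
  mdist 1%g (block_prod X j k w) =
  mdist (z0 * block_prod X 0 j w)%g (z0 * block_prod X 0 k w)%g.
Proof.
move=> jk; rewrite /block_prod (big_cat_nat (m := 0) (n := j) (p := k))//=.
by rewrite mulgA -[X in _ = mdist X _]mulg1 mdist_mull.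
Qed.

Lemma walk_dist_le z0 z1 X j k w : (j <= k)%N ->
  walk_dist z0 z1 X k w <= walk_dist z0 z1 X j w + mdist 1%g (block_prod X j k w).
Proof. by move=> jk; rewrite (block_prod_mdist z0)//; exact: metric_triangle. Qed.

Lemma block_prod_le z0 z1 X j k w : (j <= k)%N ->
  mdist 1%g (block_prod X j k w) <= walk_dist z0 z1 X j w + walk_dist z0 z1 X k w.
Proof.
move=> jk; rewrite (block_prod_mdist z0)// (le_trans (metric_triangle _ z1 _))//.
by rewrite (metric_sym _ z1).
Qed.

Lemma max_dist_gtP z0 z1 X y w : 0 <= y ->
  (y < max_dist z0 z1 X w) <-> exists2 j, (j < n)%N & y < walk_dist z0 z1 X j.+1 w.
Proof.
move=> y0; rewrite /max_dist; split.
  move=> /bigmax_gtP [|[j _]]; first by rewrite ltNge y0.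
  by rewrite partial_prodE; exists j.
move=> [j jn yj]; apply/bigmax_gtP; right; exists (Ordinal jn) => //.
by rewrite partial_prodE.
Qed.

Lemma walk_dist_le_max z0 z1 X j w : (0 < j <= n)%N ->
  walk_dist z0 z1 X j w <= max_dist z0 z1 X w.
Proof.
case: j => // j /= jn; have := @le_bigmax _ _ _ 0 (fun j : 'I_n =>
  mdist z1 (z0 * partial_prod X j w)%g) (Ordinal jn).
by rewrite partial_prodE.
Qed.

Lemma max_dist_ge0 z0 z1 X w : 0 <= max_dist z0 z1 X w.
Proof. exact: bigmax_ge_id. Qed.

Lemma max_step_ge0 X w : 0 <= max_step X w.
Proof. exact: bigmax_ge_id. Qed.

Lemma step_le_max X j w : (j < n)%N -> mdist 1%g (block_prod X j j.+1 w) <= max_step X w.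
Proof.
move=> jn; rewrite /block_prod big_nat1.
have := @le_bigmax _ _ _ 0 (fun i : 'I_n => mdist 1%g (X i w)) (Ordinal jn).
by rewrite -(step_ord X (Ordinal jn)).
Qed.

Lemma max_step_gtP X y w : 0 <= y ->
  (y < max_step X w) <-> exists i, y < mdist 1%g (X i w).
Proof.
move=> y0; rewrite /max_step; split.
  by move=> /bigmax_gtP [|[j _ ?]]; [rewrite ltNge y0|exists j].
by move=> [j yj]; apply/bigmax_gtP; right; exists j.
Qed.

End walk.

Section hoffmann_jorgensen.
Context d (Omega : measurableType d) (R : realType) (P : probability Omega R).
Context (G : metricMonoidType R) (n : nat) (X : 'I_n -> Omega -> G).
Hypothesis sG : separable G.
Hypothesis mX : forall i, borel_measurable (X i).
Hypothesis iX : mutually_independent P X.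

Lemma adapted_block_prod (S : set (set Omega)) a b : sigma_algebra setT S ->
  (forall i : 'I_n, (a <= i < b)%N -> adapted S (X i)) ->
  adapted S (block_prod X a b).
Proof.
move=> hS aX; apply: adapted_prod => // i iab.
rewrite /step; case: insubP => [j _ ij|_]; last exact: adapted_cst.
by apply: aX; rewrite ij.
Qed.

Lemma adapted_walk_dist (S : set (set Omega)) k z0 z1 y : sigma_algebra setT S ->
  (forall i : 'I_n, (i < k)%N -> adapted S (X i)) ->
  S [set w | y < walk_dist z0 z1 X k w].
Proof.
move=> hS aX; apply: adapted_mdist_gt => //.
by apply: adapted_mul => //; [exact: adapted_cst|exact: adapted_block_prod].
Qed.

Let mS := sigma_algebra_measurable Omega.

Lemma measurable_walk_dist z0 z1 k : measurable_fun setT (walk_dist z0 z1 X k).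
Proof.
by apply: measurable_fun_tails => y; apply: (adapted_walk_dist _ _ _ mS) => i _; exact: mX.
Qed.

Lemma measurable_max_dist z0 z1 : measurable_fun setT (max_dist z0 z1 X).
Proof.
apply: measurable_fun_tails => y.
have [y0|y0] := leP 0 y; last first.
  rewrite (_ : [set _ | _] = setT); first exact: measurableT.
  by apply/seteqP; split => // w _ /=; rewrite (lt_le_trans y0)// max_dist_ge0.
rewrite (_ : [set _ | _] = \bigcup_(j in [set j | (j < n)%N])
    [set w | y < walk_dist z0 z1 X j.+1 w]).
  by apply: bigcup_measurable => j _; apply: measurable_tail_set; exact: measurable_walk_dist.
apply/seteqP; split => w /=; first by move=> /max_dist_gtP-/(_ y0).
by move=> h; apply/max_dist_gtP.
Qed.

Lemma measurable_max_step : measurable_fun setT (max_step X).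
Proof.
apply: measurable_fun_tails => y.
have [y0|y0] := leP 0 y; last first.
  rewrite (_ : [set _ | _] = setT); first exact: measurableT.
  by apply/seteqP; split => // w _ /=; rewrite (lt_le_trans y0)// max_step_ge0.
rewrite (_ : [set _ | _] = \bigcup_i [set w | y < mdist 1%g (X i w)]).
  by apply: (sigma_bigcup_fin mS) => j _; apply: adapted_mdist_gt; exact: mX.
apply/seteqP; split => w /=.
  by move=> /max_step_gtP-/(_ y0)[i ?]; exists i.
by move=> [i _ ?]; apply/max_step_gtP => //; exists i.
Qed.

(** The events [A j] are disjoint with union in [U > y], each [B j] is independent
    of [A j] and contained in [U > y]: summing over the stopping index [j]
    yields the square. *)
Theorem hoffmann_jorgensen z0 z1 y : mdist z1 z0 <= y ->
  (P [set w | (4 * y < max_dist z0 z1 X w)%R] <=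
   P [set w | (y < max_dist z0 z1 X w)%R] * P [set w | (y < max_dist z0 z1 X w)%R]
   + P [set w | (y < max_step X w)%R])%E.
Proof.
move=> my; have y0 : 0 <= y by apply: le_trans my; exact: mdist_ge0.
pose V := walk_dist z0 z1 X.
(* A j: the walk first exceeds y after step j; B j: a later increment exceeds 2 y. *)
pose A (j : nat) := [set w | y < V j.+1 w] `&`
  \bigcap_(i in [set i : 'I_j | true]) ~` [set w | y < V i.+1 w].
pose B (j : nat) := \bigcup_(k in [set k : 'I_n | (j < k)%N])
  [set w | 2 * y < mdist 1%g (block_prod X j.+1 k.+1 w)].
pose past (j : nat) := [set i : 'I_n | (i <= j)%N]%SET.
pose future (j : nat) := [set i : 'I_n | (j < i)%N]%SET.
have sA j : <<s cylinder X (past j) >> (A j).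
  have sS := smallest_sigma_algebra setT (cylinder X (past j)).
  have aV i : (i <= j)%N -> <<s cylinder X (past j) >> [set w | y < V i.+1 w].
    move=> ij; apply: adapted_walk_dist => // k ki; apply: adapted_cylinder.
    by rewrite inE -ltnS (leq_trans ki).
  apply: (sigma_setI sS); first exact: aV.
  apply: (sigma_bigcap_fin sS) => i _; apply: (sigma_setC sS); apply: aV.
  by rewrite ltnW.
have sB j : <<s cylinder X (future j) >> (B j).
  have sS := smallest_sigma_algebra setT (cylinder X (future j)).
  apply: (sigma_bigcup_fin sS) => k /= jk; apply: adapted_mdist_gt.
  apply: adapted_block_prod => // i /andP[ji _]; apply: adapted_cylinder.
  by rewrite inE.
have disj j i : i \in past j -> i \notin future j.
  by rewrite !inE -leqNgt.
have mA j : measurable (A j).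
  by have [] := block_independent mX iX (disj j) (sA j) (sB j).
have mB j : measurable (B j).
  by have [] := block_independent mX iX (disj j) (sA j) (sB j).
have AB j : P (A j `&` B j) = (P (A j) * P (B j))%E.
  by have [] := block_independent mX iX (disj j) (sA j) (sB j).
have mU z : measurable [set w | z < max_dist z0 z1 X w].
  by apply: measurable_tail_set; exact: measurable_max_dist.
have mM z : measurable [set w | z < max_step X w].
  by apply: measurable_tail_set; exact: measurable_max_step.
set q := P [set w | (y < max_dist z0 z1 X w)%R].
have Bq j : (P (B j) <= q)%E.
  apply: le_measure; rewrite ?inE// => w [k /= jk].
  have := @block_prod_le _ _ _ _ _ z0 z1 X j.+1 k.+1 w.
    rewrite ltnS (ltnW jk) => /(_ isT) h1 h2.
  have kn := ltn_ord k.
  have h3 := @walk_dist_le_max _ _ _ _ _ z0 z1 X j.+1 w.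
  have h4 := @walk_dist_le_max _ _ _ _ _ z0 z1 X k.+1 w.
  have {}h3 := h3 (ltn_trans jk kn); have {}h4 := h4 kn; lra.
have tA : trivIset setT A.
  apply/trivIsetP => i j _ _; wlog ij : i j / (i < j)%N.
    move=> W; rewrite neq_ltn => /orP[ij|ji].
      by apply: W => //; rewrite neq_ltn ij.
    by rewrite setIC; apply: W => //; rewrite neq_ltn ji.
  move=> _; apply/seteqP; split => w //= [[Vi _] [_ Aj]].
  exact: (Aj (Ordinal ij)).
have sub : [set w | 4 * y < max_dist z0 z1 X w] `<=`
    \big[setU/set0]_(j < n) (A j `&` B j) `|` [set w | y < max_step X w].
  move=> w /= Uw; have [yM|My] := ltP y (max_step X w); [by right|left].
  have y4 : 0 <= 4 * y by rewrite mulr_ge0.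
  have [k kn Vk] := (max_dist_gtP z0 z1 X w y4).1 Uw.
  have exj : exists j, (j < n)%N && (y < V j.+1 w).
    by exists k; rewrite kn/=; apply: le_lt_trans Vk; lra.
  (* The stopping index j is the first one at which the distance exceeds y. *)
  case: (ex_minnP exj) => j /andP[jn yj] jmin.
  rewrite -(bigcup_mkord n (fun j => A j `&` B j)); exists j => //; split.
    split => // i _ /= yi.
    have := jmin i; rewrite (ltn_trans (ltn_ord i) jn) yi => /(_ isT).
    by rewrite leqNgt ltn_ord.
  (* At j = 0 the walk is at its starting point, whence the hypothesis on z0, z1. *)
  have Vj : V j w <= y.
    case: (j) jn jmin => [|j'] jn jmin; first by rewrite /V walk_dist0.
    rewrite leNgt; apply/negP => yV.
    by have := jmin j'; rewrite (ltn_trans _ jn)// yV ltnn => /(_ isT).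
  have h1 := @walk_dist_le _ _ _ _ _ z0 z1 X j j.+1 w (leqnSn j).
  have h2 := step_le_max X w jn.
  have Vj1 : V j.+1 w <= 2 * y by rewrite /V; rewrite /V in Vj; lra.
  have jk : (j < k)%N.
    rewrite ltn_neqAle; apply/andP; split; last first.
      apply: jmin; rewrite kn/=; apply: le_lt_trans Vk; lra.
    apply/eqP => jk; move: Vk; rewrite -jk; move: Vj1; rewrite /V; lra.
  exists (Ordinal kn) => //=.
  have := @walk_dist_le _ _ _ _ _ z0 z1 X j.+1 k.+1 w.
    rewrite ltnS (ltnW jk) => /(_ isT).
  move: Vj1 Vk; rewrite /V; lra.
have mABn : measurable (\big[setU/set0]_(j < n) (A j `&` B j)).
  by apply: bigsetU_measurable => j _; exact: measurableI.
apply: (@le_trans _ _ (P (\big[setU/set0]_(j < n) (A j `&` B j) `|`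
    [set w | y < max_step X w]))).
  apply: le_measure; rewrite ?inE//; exact: measurableU.
apply: (le_trans (measureU2 _ _ _)) => //.
rewrite leeD2r// (measure_bigsetU P (F := fun j => A j `&` B j))//; last 2 first.
  by move=> j; exact: measurableI.
  exact: trivIset_setIr.
apply: (@le_trans _ _ (\sum_(j < n) P (A j) * q)%E).
  apply: lee_sum => j _; apply: (@le_trans _ _ (P (A j) * P (B j))%E).
    by rewrite -AB.
  exact: lee_wpmul2l.
rewrite -ge0_sume_distrl; last by move=> j _; exact: measure_ge0.
apply: lee_wpmul2r; first exact: measure_ge0.
rewrite -(@measure_bigsetU _ _ _ P A mA tA n); apply: le_measure; rewrite ?inE//.
  exact: bigsetU_measurable.
rewrite -(bigcup_mkord n A) => w [j /= jn [yj _]].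
by apply/max_dist_gtP => //; exists j.
Qed.

End hoffmann_jorgensen.

(** * The quantile function of the step counts *)

(** From [(1 - p) * (1 + p) <= 1]: the probability that none of several
    independent events happens is at most [1 / (1 + sum of their
    probabilities)]. *)
Lemma prod_onem_mul_le1 (R : realFieldType) (I : Type) (r : seq I) (p : I -> R) :
  (forall i, 0 <= p i <= 1) ->
  0 <= \prod_(i <- r) (1 - p i) /\
  (\prod_(i <- r) (1 - p i)) * (1 + \sum_(i <- r) p i) <= 1.
Proof.
move=> p01; elim: r => [|i r [IH0 IH1]]; first by rewrite !big_nil addr0 mulr1.
rewrite !big_cons; have /andP[pi0 pi1] := p01 i.
have S0 : 0 <= \sum_(j <- r) p j by apply: sumr_ge0 => j _; have /andP[] := p01 j.
split; first by rewrite mulr_ge0// subr_ge0.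
apply: le_trans IH1; rewrite mulrAC mulrC ler_wpM2l//; nra.
Qed.

Section ell.
Context d (Omega : measurableType d) (R : realType) (P : probability Omega R).
Context (G : metricMonoidType R) (n : nat) (X : 'I_n -> Omega -> G).
Hypothesis mX : forall i, borel_measurable (X i).
Notation leb := (@lebesgue_measure R).

Definition step_count (y : R) : R :=
  \sum_(i < n) fine (P [set w | y < mdist 1%g (X i w)]).

Let mS := sigma_algebra_measurable Omega.

Let mev i y : measurable [set w | y < mdist 1%g (X i w)].
Proof. by apply: adapted_mdist_gt; exact: mX. Qed.

Lemma step_countE y :
  (\sum_(i < n) P [set w | (y < mdist 1%g (X i w))%R] = (step_count y)%:E)%E.
Proof.
by rewrite -sumEFin; apply: eq_bigr => i _; rewrite fineK// fin_num_measure.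
Qed.

Lemma step_count_ge0 y : 0 <= step_count y.
Proof. by apply: sumr_ge0 => i _; exact: fine_ge0. Qed.

Lemma step_count_le y y' : y <= y' -> step_count y' <= step_count y.
Proof.
move=> yy'; apply: ler_sum => i _; apply: fine_le; rewrite ?fin_num_measure//.
by apply: le_measure; rewrite ?inE// => w /=; exact: le_lt_trans.
Qed.

(** Right continuity of the step count, the reason why [ell] inverts it exactly
    and not only up to the boundary of its level sets. *)
Lemma step_count_right y t :
  (forall y', y < y' -> step_count y' <= t) -> step_count y <= t.
Proof.
move=> H; rewrite -lee_fin -step_countE; apply: tail_sum_right => [i|y' yy'].
  by apply: measurable_fun_tails => z; exact: mev.
by rewrite step_countE lee_fin H.
Qed.

Lemma tail_max_step_le y : 0 <= y ->
  (P [set w | (y < max_step X w)%R] <= (step_count y)%:E)%E.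
Proof.
move=> y0; pose F (i : nat) := [set w | y < mdist 1%g (step X i w)].
have mF i : measurable (F i).
  rewrite /F /step; case: insubP => [j _ _|_]; first exact: mev.
  exact: (adapted_mdist_gt 1%g y (adapted_cst mS (1%g : G))).
have -> : (step_count y)%:E = (\sum_(i < n) P (F i))%E.
  by rewrite -step_countE; apply: eq_bigr => i _; rewrite /F step_ord.
apply: content_subadditive => //.
  by apply: measurable_tail_set; exact: measurable_max_step.
move=> w /= /max_step_gtP -/(_ y0)[i yi].
by rewrite -(bigcup_mkord n F); exists i => //=; rewrite /F/= step_ord.
Qed.

Lemma ellE z0 t : ell P z0 X t = if 0 <= t <= 1 then
    ereal_inf [set y%:E | y in [set y | 0 < y /\ step_count y <= t]] else 0%E.
Proof.
rewrite /ell; case: ifP => // _; congr (ereal_inf (image _ _)).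
apply/seteqP; split => y /= [y0]; under eq_bigr do
  (under eq_set do rewrite -{1}[z0]mulg1 mdist_mull); by rewrite step_countE lee_fin.
Qed.

Lemma ell_ge0 z0 t : (0 <= ell P z0 X t)%E.
Proof.
rewrite ellE; case: ifP => // _; apply: le_ereal_inf_tmp => _ [y [y0 _] <-].
by rewrite lee_fin ltW.
Qed.

(** This is the Galois connection between a nonincreasing right-continuous
    function and its generalized inverse; it makes [ell] and [step_count] have
    the same distribution tails. *)
Lemma ell_gt z0 t y : 0 <= y ->
  (y%:E < ell P z0 X t)%E <-> 0 <= t <= 1 /\ t < step_count y.
Proof.
move=> y0; rewrite ellE; case: ifP => t01; last first.
  by rewrite lte_fin ltNge y0; split => // -[].
set A := [set _ | _ in _]; split => [yl|[_ ty]].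
  split => //; rewrite ltNge; apply/negP => H.
  have [y' /andP[yy' y'l]] : exists y', (y < y') && (y'%:E < ereal_inf A)%E.
    move: yl; case: (ereal_inf _) => [a| |] // yl.
      exists ((y + a) / 2); move: yl; rewrite !lte_fin => ya; apply/andP; split; lra.
    by exists (y + 1); rewrite ltry ltrDl ltr01.
  move: y'l; rewrite ltNge => /negP; apply.
  apply: ereal_inf_lbound; exists y' => //; split; first exact: le_lt_trans yy'.
  by apply: le_trans H; apply: step_count_le; exact: ltW.
rewrite ltNge; apply/negP => H; move: ty; rewrite ltNge => /negP; apply.
apply: step_count_right => y' yy'.
have : (ereal_inf A < y'%:E)%E.
  by apply: le_lt_trans H _; rewrite lte_fin.
move=> /ereal_inf_lt[_ [z [z0' zt] <-]]; rewrite lte_fin => zy'.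
by apply: le_trans zt; apply: step_count_le; exact: ltW.
Qed.

Lemma ell_tail_setE z0 y : 0 <= y ->
  [set t | (y%:E < ell P z0 X t)%E] = `[0, 1] `&` `]-oo, step_count y[.
Proof.
move=> y0; apply/seteqP; split => t /=.
  by move=> /ell_gt -/(_ y0) [? ?]; rewrite !in_itv.
by rewrite !in_itv/= => -[? ?]; apply/ell_gt.
Qed.

Lemma measurable_ell z0 : measurable_fun setT (ell P z0 X).
Proof.
apply: measurable_efun_tails => y; have [y0|y0] := leP 0 y.
  by rewrite ell_tail_setE//; exact: measurableI.
rewrite (_ : [set _ | _] = setT)//; apply/seteqP; split => // t _ /=.
by apply: lt_le_trans (ell_ge0 z0 t); rewrite lte_fin.
Qed.

Lemma ell_tail z0 y : 0 <= y ->
  leb [set t | (y%:E < ell P z0 X t)%E] = (Num.min 1 (step_count y))%:E.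
Proof.
move=> y0; rewrite ell_tail_setE//; have N0 := step_count_ge0 y.
have [N1|N1] := ltP 1 (step_count y).
  rewrite setIidl; last first.
    by move=> t /=; rewrite !in_itv/= => /andP[_ t1]; exact: le_lt_trans N1.
  by rewrite lebesgue_measure_itv/= lte_fin ltr01 -EFinB subr0.
rewrite (_ : _ `&` _ = `[0, step_count y[%classic).
  rewrite lebesgue_measure_itv/= lte_fin; case: ltP => N0'.
    by rewrite -EFinB subr0.
  by congr (_%:E); apply/le_anti/andP.
apply/seteqP; split => t /=; rewrite !in_itv/=; first by move=> [/andP[-> _] ->].
by move=> /andP[-> tN]; split => //=; apply: le_trans N1; exact: ltW.
Qed.

Lemma ell_tail_le1 z0 y : 0 <= y -> (leb [set t | (y%:E < ell P z0 X t)%E] <= 1)%E.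
Proof. by move=> y0; rewrite ell_tail// lee_fin ge_min lexx. Qed.

(** The union bound: [tail_max_step_le], capped at [1]. *)
Lemma max_step_le_ell_tail z0 y : 0 <= y ->
  (P [set w | (y < max_step X w)%R] <= leb [set t | (y%:E < ell P z0 X t)%E])%E.
Proof.
move=> y0; rewrite ell_tail// EFin_min le_min tail_max_step_le// andbT.
by apply: probability_le1; apply: measurable_tail_set; exact: measurable_max_step.
Qed.

Lemma step_count_ell z0 t y : 0 <= t <= 1 -> ell P z0 X t = y%:E -> step_count y <= t.
Proof.
move=> t01 ty; have y0 : 0 <= y by rewrite -lee_fin -ty ell_ge0.
by rewrite leNgt; apply/negP => h; have := (ell_gt z0 t y0).2 (conj t01 h); rewrite ty ltxx.
Qed.

Lemma ell_nonincreasing z0 s t : 0 <= s -> s <= t -> t <= 1 ->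
  (ell P z0 X t <= ell P z0 X s)%E.
Proof.
move=> s0 st t1; rewrite !ellE s0 (le_trans st t1) t1 (le_trans s0 st)/=.
by apply: ereal_inf_le_tmp => _ [y [y0 ys] <-]; exists y => //; split => //; exact: le_trans st.
Qed.

Lemma ell_moment z0 p : 0 < p ->
  (\int[leb]_(t in `[0%R, 1%R]) (ell P z0 X t `^ p) = \int[leb]_t (ell P z0 X t `^ p))%E.
Proof.
move=> p0; rewrite integral_mkcond; apply: eq_integral => t _.
rewrite patchE; case: ifPn => // ; rewrite notin_setE/= in_itv/= => /negP t01.
by rewrite ellE (negbTE t01) poweR0r// gt_eqF.
Qed.

(** Markov's inequality for the nonincreasing function [ell], which is at least
    [ell t] on the whole interval [[0, t]]. *)
Lemma ell_moment_ge z0 p t : 0 < p -> 0 < t -> t <= 1 ->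
  (t%:E * ell P z0 X t `^ p <= \int[leb]_s (ell P z0 X s `^ p))%E.
Proof.
move=> p0 t0 t1; rewrite -ell_moment//.
apply: (@le_trans _ _ (\int[leb]_(s in `[0%R, t]) (ell P z0 X s `^ p))%E); last first.
  apply: ge0_subset_integral => //.
  - apply: measurable_funTS; apply: measurable_fun_poweR; exact: measurable_ell.
  - by move=> s _; exact: poweR_ge0.
  - by move=> s /=; rewrite !in_itv/= => /andP[-> st]; exact: le_trans t1.
apply: (@le_trans _ _ (\int[leb]_(s in `[0%R, t]) (cst (ell P z0 X t `^ p) s))%E).
  have lt : leb `[0, t]%classic = t%:E.
    by rewrite lebesgue_measure_itv/= lte_fin t0 -EFinB subr0.
  apply: (@le_trans _ _ (ell P z0 X t `^ p * leb `[0%R, t]%classic)%E).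
    by rewrite lt muleC.
  by rewrite integral_cst.
apply: ge0_le_integral => //.
- by move=> s _; exact: poweR_ge0.
- by apply: measurable_funTS; apply: measurable_fun_poweR; exact: measurable_ell.
move=> s /=; rewrite in_itv/= => /andP[s0 st].
apply: gt0_ler_poweR; rewrite ?in_itv/= ?ell_ge0 ?leey// ?(ltW p0)//.
exact: ell_nonincreasing.
Qed.

Hypothesis iX : mutually_independent P X.

(** The converse of the union bound, by independence: if [q] is the probability
    on the right and [N] the step count, then [(1 - q) * (1 + N) <= 1], which
    gives [N / (1 + N) <= q]. *)
Lemma ell_tail_le_max_step z0 y : 0 <= y ->
  (leb [set t | (y%:E < ell P z0 X t)%E] <= 2%:E * P [set w | (y < max_step X w)%R])%E.
Proof.
move=> y0; rewrite ell_tail//.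
set E := [set w | _].
have mE : measurable E by apply: measurable_tail_set; exact: measurable_max_step.
pose A i := [set w | y < mdist 1%g (X i w)].
have CE : ~` E = \bigcap_(i in [set` [set: 'I_n]%SET]) X i @^-1` ~` [set x | y < mdist 1%g x].
  apply/seteqP; split => w /=.
    by move=> nE i _ /= yi; apply: nE; apply/max_step_gtP => //; exists i.
  by move=> H /(max_step_gtP _ _ y0)[i yi]; apply: (H i) => //=; rewrite inE.
have PC : P (~` E) = (\prod_(i < n) (1 - fine (P (A i))))%:E.
  rewrite CE iX; last first.
    move=> i _; apply: (sigma_setC (smallest_sigma_algebra _ _)).
    by apply: sub_sigma_algebra; exact: open_mdist_gt.
  rewrite -prodEFin; apply: eq_big => [i|i _]; first by rewrite inE.
  by rewrite preimage_setC probability_setC ?EFinB ?fineK ?fin_num_measure//; exact: mev.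
move: PC; rewrite probability_setC//.
have fE : P E \is a fin_num by exact: fin_num_measure.
have : (0 <= P E)%E by exact: measure_ge0.
have : (P E <= 1)%E by exact: probability_le1.
move: fE; case: (P E) => // q _; rewrite !lee_fin -EFinB => q1 q0 [] qe.
have p01 (i : 'I_n) : 0 <= fine (P (A i)) <= 1.
  rewrite fine_ge0//= -lee_fin fineK ?fin_num_measure//; last exact: mev.
  by apply: probability_le1; exact: mev.
have [_] := prod_onem_mul_le1 (index_enum 'I_n) p01.
rewrite -qe -/(step_count y) => H.
have N0 := step_count_ge0 y.
rewrite ge_min; have [N1|N1] := leP (step_count y) 1; apply/orP; [right|left]; nra.
Qed.

End ell.

(** * Decreasing rearrangements and roots of moments *)

Section rearrangement.
Context d (Omega : measurableType d) (R : realType) (P : probability Omega R).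

Lemma rearrangement_ge0 (Z : Omega -> R) t : (0 <= rearrangement P Z t)%E.
Proof. by rewrite /rearrangement le_max lexx. Qed.

Lemma rearrangement_le (Z : Omega -> R) t y : measurable_fun setT Z -> 0 <= y ->
  (P [set w | (y < Z w)%R] <= t%:E)%E -> (rearrangement P Z t <= y%:E)%E.
Proof.
move=> mZ y0 Pt; rewrite /rearrangement ge_max lee_fin y0/=.
apply: ge_ereal_sup => _ [y' [y'0 ty'] <-].
rewrite lee_fin leNgt; apply/negP => yy'.
move: ty'; rewrite ltNge => /negP; apply; apply: le_trans Pt.
apply: le_measure; rewrite ?inE; do ?exact: measurable_tail_set.
by move=> w /=; exact: lt_trans.
Qed.

(** The supremum itself is an admissible level because the tail is right
    continuous. *)
Lemma rearrangement_tail (Z : Omega -> R) t u : measurable_fun setT Z ->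
  (rearrangement P Z t <= u%:E)%E -> (P [set w | (u < Z w)%R] <= t%:E)%E.
Proof.
move=> mZ ru; have u0 : 0 <= u.
  by rewrite -lee_fin; apply: le_trans ru; exact: rearrangement_ge0.
apply: tail_right => // y' uy'; rewrite leNgt; apply/negP => ty'.
have : (y'%:E <= u%:E)%E.
  apply: le_trans ru; rewrite /rearrangement le_max; apply/orP; right.
  by apply: ereal_sup_ubound; exists y' => //; split => //; rewrite (le_trans u0)// ltW.
by rewrite lee_fin leNgt uy'.
Qed.

Lemma moment_rootE (Z : Omega -> R) p :
  moment_root P Z p = ((\int[P]_w (Z w `^ p)%:E) `^ p^-1)%E.
Proof. by rewrite /moment_root unlock. Qed.

Lemma markov_moment (Z : Omega -> R) p y : measurable_fun setT Z ->
  (forall w, 0 <= Z w) -> 0 < p -> 0 <= y ->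
  ((y `^ p)%:E * P [set w | (y < Z w)%R] <= \int[P]_w (Z w `^ p)%:E)%E.
Proof.
move=> mZ Z0 p0 y0; set E := [set w | _].
have mE : measurable E by exact: measurable_tail_set.
have mZp : measurable_fun setT (fun w => (Z w `^ p)%:E).
  by apply/measurable_EFinP; exact: (measurableT_comp (measurable_powR p)).
apply: (@le_trans _ _ (\int[P]_(w in E) (Z w `^ p)%:E)%E); last first.
  by apply: ge0_subset_integral => // w _; rewrite lee_fin powR_ge0.
rewrite -integral_cst//; apply: ge0_le_integral => //.
- by move=> w _; rewrite lee_fin powR_ge0.
- exact: measurable_funTS.
by move=> w yw; rewrite lee_fin ge0_ler_powR ?nnegrE ?(ltW p0) ?Z0// ltW.
Qed.

End rearrangement.

Section powers.
Context (R : realType).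
Implicit Types (p a b x y l t C : R).

Lemma powRK x p : p != 0 -> 0 <= x -> (x `^ p) `^ p^-1 = x.
Proof. by move=> p0 x0; rewrite -powRrM mulfV// powRr1. Qed.

Lemma le_root_mul p t x l C : 0 < p -> 0 < t -> 0 <= x -> 0 <= l ->
  t^-1 `^ p^-1 <= C -> t * x `^ p <= l `^ p -> x <= C * l.
Proof.
move=> p0 t0 x0 l0 tC H.
rewrite -(@powRK x p) ?gt_eqF// (@le_trans _ _ ((t^-1 * l `^ p) `^ p^-1))//.
  apply: ge0_ler_powR; rewrite ?nnegrE ?invr_ge0 ?powR_ge0 ?(ltW p0)//.
    by rewrite mulr_ge0 ?powR_ge0// invr_ge0 ltW.
  by rewrite mulrC ler_pdivlMr// mulrC.
by rewrite powRM ?powR_ge0 ?invr_ge0 ?(ltW t0)// powRK ?gt_eqF// ler_wpM2r.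
Qed.

Lemma root_le_bound p0 p a b : 0 < p0 -> p0 <= p -> 1 <= a -> a <= b ->
  a `^ p^-1 <= b `^ p0^-1.
Proof.
move=> p00 pp0 a1 ab; have p0' : 0 < p by exact: lt_le_trans pp0.
apply: (@le_trans _ _ (a `^ p0^-1)).
  by apply: ler_powR => //; rewrite lef_pV2.
apply: ge0_ler_powR; rewrite ?nnegrE ?invr_ge0 ?(ltW p00)//; lra.
Qed.

Lemma expR_root p a : 0 < p -> 0 < a ->
  (expR (- p) / a)^-1 `^ p^-1 = expR 1 * a `^ p^-1.
Proof.
move=> p0 a0; rewrite invf_div expRN invrK mulrC powRM ?expR_ge0 ?(ltW a0)//.
by rewrite -expRM mulfV ?gt_eqF.
Qed.

(** From [e = (exp(1/7))^7 >= (8/7)^7]. *)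
Lemma expR3_ge16 : 16 <= expR 3 :> R.
Proof.
have -> : (3 : R) = 7^-1 * 21%:R by field.
rewrite expRM_natr; apply: (@le_trans _ _ ((1 + 7^-1) ^+ 21)); last first.
  by rewrite lerXn2r ?nnegrE ?expR_ge0 ?expR_ge1Dx.
lra.
Qed.

End powers.

(** * The four comparisons *)

Section comparison.
Context d (Omega : measurableType d) (R : realType) (P : probability Omega R).
Context (G : metricMonoidType R) (n : nat) (X : 'I_n -> Omega -> G).
Hypothesis n0 : (0 < n)%N.
Hypothesis sG : separable G.
Hypothesis mX : forall i, borel_measurable (X i).
Hypothesis iX : mutually_independent P X.
Notation leb := (@lebesgue_measure R).

Let mU z0 z1 : measurable_fun setT (max_dist z0 z1 X).
Proof. exact: measurable_max_dist. Qed.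

Let mM : measurable_fun setT (max_step X).
Proof. exact: measurable_max_step. Qed.

Lemma unit_moment_rootE z0 p l : 0 < p ->
  unit_moment_root (ell P z0 X) p = l%:E ->
  0 <= l /\ (\int[leb]_t (ell P z0 X t `^ p) = (l `^ p)%:E)%E.
Proof.
move=> p0 El; have l0 : 0 <= l by rewrite -lee_fin -El; exact: poweR_ge0.
split => //; rewrite -poweR_EFin -El /unit_moment_root ell_moment//.
rewrite -poweRrM mulVf ?gt_eqF// poweRe1//.
by apply: integral_ge0 => t _; exact: poweR_ge0.
Qed.

(** Besides bounding [ell t], finiteness of the moment makes [ell t] a real
    number, so that it can serve as a truncation level. *)
Lemma ell_quantile z0 p l t C : 0 < p -> 0 < t <= 1 ->
  unit_moment_root (ell P z0 X) p = l%:E -> t^-1 `^ p^-1 <= C ->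
  exists y, [/\ ell P z0 X t = y%:E, 0 <= y & y <= C * l].
Proof.
move=> p0 /andP[t0 t1] /(unit_moment_rootE p0)[l0 El] tC.
have := ell_moment_ge P mX z0 p0 t0 t1; rewrite El.
have := ell_ge0 P mX z0 t; case: (ell P z0 X t) => [y| |]//.
  rewrite lee_fin => y0; rewrite poweR_EFin -EFinM lee_fin => H.
  by exists y; split => //; exact: (le_root_mul p0 t0).
by move=> _; rewrite poweRyr ?gt_eqF// gt0_muley ?lte_fin.
Qed.

Lemma tail_max_step_ell z0 t y : 0 <= t <= 1 -> ell P z0 X t = y%:E ->
  (P [set w | (y < max_step X w)%R] <= t%:E)%E.
Proof.
move=> t01 ty; have y0 : 0 <= y by rewrite -lee_fin -ty; exact: ell_ge0.
by apply: le_trans (tail_max_step_le P mX y0) _; rewrite lee_fin; exact: step_count_ell ty.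
Qed.

(** The events [U > u] and [M > y] have total probability at most [3/4], so some
    outcome avoids both; there the first step has size at most [y] and ends
    within [u] of [z1]. *)
Lemma start_dist_le z0 z1 s u y : 0 <= u -> s <= 1 / 4 ->
  (P [set w | (u < max_dist z0 z1 X w)%R] <= s%:E)%E ->
  ell P z0 X (1 / 2) = y%:E -> mdist z1 z0 <= u + y.
Proof.
move=> u0 s4 Pu ly; rewrite leNgt; apply/negP => uy.
have h2 : 0 <= (1 / 2 : R) <= 1 by apply/andP; split; lra.
have PM := tail_max_step_ell h2 ly.
have : (P setT <= s%:E + (1 / 2)%:E)%E.
  apply: (@le_trans _ _ (P ([set w | u < max_dist z0 z1 X w] `|`
    [set w | y < max_step X w]))).
    apply: le_measure; rewrite ?inE//.
      by apply: measurableU; exact: measurable_tail_set.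
    move=> w _ /=; have [?|Uu] := ltP u (max_dist z0 z1 X w); [by left|right].
    rewrite ltNge; apply/negP => My.
    have := walk_dist_le_max z0 z1 X (j := 1%N) w; rewrite n0 => /(_ isT).
    have := block_prod_le z0 z1 X w (leq0n 1).
    have := metric_triangle z1 (z0 * block_prod X 0 1 w)%g z0.
    rewrite (metric_sym (z0 * block_prod X 0 1 w)%g z0).
    have := block_prod_mdist z0 X w (leq0n 1).
    rewrite {2}/block_prod big_geq// mulg1 => <-.
    rewrite -/(walk_dist z0 z1 X 1 w).
    have := step_le_max X w n0; lra.
  apply: (le_trans (measureU2 _ _ _)); try exact: measurable_tail_set.
  exact: leeD.
rewrite probability_setT -EFinD lee_fin; lra.
Qed.

(** Two applications of the Hoffmann-Jorgensen inequality, at the levels [y] and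
    [4y], give with [q = P (U > y)] and [a = P (M > y)] the bound
    [P (U > 16y) <= (q^2 + a)^2 + a <= q^4 + 4a], and three of the four factors
    [q] are at most [exp(-p) / 4]. *)
Lemma moment_max_dist_le z0 z1 p v : 0 < p -> mdist z1 z0 <= v ->
  (P [set w | (v < max_dist z0 z1 X w)%R] <= (expR (- p) / 4)%:E)%E ->
  (\int[P]_w (max_dist z0 z1 X w `^ p)%:E <=
   (2 * 16 `^ p)%:E * ((v `^ p)%:E + 4%:E * \int[leb]_t (ell P z0 X t `^ p)))%E.
Proof.
move=> p0 mv Pv; have v0 : 0 <= v by apply: le_trans mv; exact: mdist_ge0.
have e0 := expR_gt0 (- p).
apply: (@good_lambda _ _ _ P _ _ leb _ _ p v 16 ((expR (- p) / 4) ^+ 3) 4) => //.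
- lra.
(* The absorption condition of the good-lambda inequality, from 16 <= e^3. *)
- have H : (16 : R) `^ p * expR (- p) ^+ 3 <= 1.
    have -> : expR (- p) ^+ 3 = (expR 3 `^ p)^-1.
      by rewrite -expRM -expRN -expRM_natr; congr expR; ring.
    rewrite ler_pdivrMr ?powR_gt0 ?expR_gt0// mul1r.
    by apply: ge0_ler_powR; rewrite ?nnegrE ?expR_ge0 ?(ltW p0)// expR3_ge16.
  rewrite expr_div_n; move: H; set A := _ * _ => H.
  have -> : 2 * (16 `^ p * (expR (- p) ^+ 3 / 4 ^+ 3)) = A / 32 by rewrite /A; field.
  lra.
- by move=> w; exact: max_dist_ge0.
- exact: measurable_ell.
- by move=> t; exact: ell_ge0.
move=> y vy; have y0 : 0 <= y by exact: le_trans vy.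
have my : mdist z1 z0 <= y by exact: le_trans vy.
have my4 : mdist z1 z0 <= 4 * y by apply: le_trans my _; lra.
have HJ1 := hoffmann_jorgensen sG mX iX my.
have HJ2 := hoffmann_jorgensen sG mX iX my4.
have Mell := max_step_le_ell_tail P mX z0 y0.
have fP A : measurable A -> exists a, [/\ P A = a%:E, 0 <= a & a <= 1].
  move=> mA; exists (fine (P A)); rewrite fineK ?fin_num_measure//; split => //.
    by rewrite fine_ge0.
  by rewrite -lee_fin fineK ?fin_num_measure//; exact: probability_le1.
have [q [Eq q0 q1]] := fP _ (measurable_tail_set y (mU z0 z1)).
have [q4 [Eq4 q40 _]] := fP _ (measurable_tail_set (4 * y) (mU z0 z1)).
have [a [Ea a0 a1]] := fP _ (measurable_tail_set y mM).
have [a4 [Ea4 a40 _]] := fP _ (measurable_tail_set (4 * y) mM).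
have a4a : a4 <= a.
  rewrite -lee_fin -Ea -Ea4; apply: le_measure; rewrite ?inE;
    do ?exact: measurable_tail_set.
  move=> w /=; apply: le_lt_trans; lra.
have qe : q <= expR (- p) / 4.
  rewrite -lee_fin -Eq; apply: le_trans Pv; apply: le_measure; rewrite ?inE;
    do ?exact: measurable_tail_set.
  by move=> w /=; exact: le_lt_trans.
rewrite (_ : 16 * y = 4 * (4 * y)); last by ring.
apply: (le_trans HJ2); rewrite Eq4 Ea4 Eq.
apply: (@le_trans _ _ (((expR (- p) / 4) ^+ 3 * q + 4 * a)%:E)); last first.
  by rewrite EFinD leeD// EFinM lee_wpmul2l// -Ea.
move: HJ1; rewrite Eq4 Ea Eq -!EFinM -!EFinD !lee_fin => HJ1.
have qe3 : q ^+ 3 <= (expR (- p) / 4) ^+ 3.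
  by rewrite lerXn2r ?nnegrE//; lra.
have q43 : q ^+ 4 <= (expR (- p) / 4) ^+ 3 * q by rewrite exprSr ler_wpM2r.
have q44 : q4 * q4 <= (q * q + a) * (q * q + a) by apply: ler_pM.
have qq : q * q <= 1 by rewrite -[leRHS]mulr1; apply: ler_pM.
have : (q * q + a) * (q * q + a) <= q ^+ 4 + 3 * a.
  have -> : (q * q + a) * (q * q + a) = q ^+ 4 + 2 * (q * q) * a + a * a by ring.
  have : q * q * a <= a by rewrite ler_piMl.
  have : a * a <= a by rewrite ler_piMl.
  lra.
lra.
Qed.

End comparison.

Section truncated.
Context d (Omega : measurableType d) (R : realType) (P : probability Omega R).
Context (G : metricMonoidType R) (n : nat) (X : 'I_n -> Omega -> G).
Implicit Types (t : \bar R).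

(** Left invariance moves the common base point to [1]. *)
Lemma max_dist_base1 z : max_dist z z X = max_dist 1%g 1%g X.
Proof.
apply/funext => w; rewrite /max_dist; apply: eq_bigr => j _.
by rewrite mul1g -{1}[z]mulg1 mdist_mull.
Qed.

Lemma max_dist_truncE z0 r :
  max_dist_trunc P z0 X r =
  max_dist 1%g 1%g (fun i w => truncation (ell P z0 X r) (X i w)).
Proof.
by apply/funext => w; apply: eq_bigr => j _; rewrite mul1g.
Qed.

Lemma max_dist_truncation z0 z1 (y : R) w : max_step X w <= y ->
  max_dist z0 z1 (fun i w => truncation y%:E (X i w)) w = max_dist z0 z1 X w.
Proof.
move=> My; apply: eq_bigr => j _; congr (mdist _ (_ * _)%g).
rewrite /partial_prod; apply: eq_bigr => i _; rewrite /truncation ifF//.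
apply/negbTE; rewrite lte_fin -leNgt; apply: le_trans My.
exact: (le_bigmax _ (fun i : 'I_n => mdist 1%g (X i w)) i).
Qed.

Lemma max_step_truncation (y : R) w : 0 <= y ->
  max_step (fun i w => truncation y%:E (X i w)) w <= y.
Proof.
move=> y0; apply/bigmax_leP; split=> // i _; rewrite /truncation; case: ifP => [_|].
  by rewrite mdistxx.
by move/negbT; rewrite lte_fin -leNgt.
Qed.

Lemma borel_measurable_truncation t :
  (forall i, borel_measurable (X i)) ->
  forall i, borel_measurable (fun w => truncation t (X i w)).
Proof.
move=> mX i; apply: (adapted_truncation (sigma_algebra_measurable Omega)).
exact: mX.
Qed.

Lemma mutually_independent_truncation t : mutually_independent P X ->
  mutually_independent P (fun i w => truncation t (X i w)).
Proof.
move=> iX J B mB.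
apply: (iX J (fun i => truncation t @^-1` B i)) => i iJ.
have aid : adapted <<s @open G >> (fun x : G => x) by move=> C.
exact: (adapted_truncation (smallest_sigma_algebra _ _) t aid (mB i iJ)).
Qed.

Lemma max_dist_le_start z0 z1 w :
  max_dist z0 z0 X w <= mdist z1 z0 + max_dist z0 z1 X w.
Proof.
apply/bigmax_leP; split; first by rewrite addr_ge0 ?mdist_ge0 ?max_dist_ge0.
move=> j _; apply: le_trans (metric_triangle _ z1 _) _.
rewrite (metric_sym z0 z1) lerD2l.
exact: (le_bigmax _ (fun j : 'I_n => mdist z1 (z0 * partial_prod X j w)%g) j).
Qed.

(** A step joins two consecutive positions, and the walk starts at distance [0]
    from its base point. *)
Lemma max_step_le2 z w : max_step X w <= 2 * max_dist z z X w.
Proof.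
have U0 := max_dist_ge0 z z X w.
apply/bigmax_leP; split; first by rewrite mulr_ge0.
move=> i _; have := block_prod_le z z X w (leqnSn i).
rewrite {1}/block_prod big_nat1 step_ord.
have := walk_dist_le_max z z X (j := i.+1) w; rewrite ltn_ord => /(_ isT).
have : walk_dist z z X i w <= max_dist z z X w.
  case: (posnP i) => [->|i0]; first by rewrite walk_dist0 mdistxx.
  by apply: walk_dist_le_max; rewrite i0 ltnW.
lra.
Qed.

End truncated.

Section four_inequalities.
Context d (Omega : measurableType d) (R : realType) (P : probability Omega R).
Context (G : metricMonoidType R) (n : nat) (X : 'I_n -> Omega -> G).
Hypothesis n0 : (0 < n)%N.
Hypothesis sG : separable G.
Hypothesis mX : forall i, borel_measurable (X i).
Hypothesis iX : mutually_independent P X.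
Context (p0 p : R) (p00 : 0 < p0) (pp0 : p0 <= p).
Notation leb := (@lebesgue_measure R).
Notation K := (16 `^ p0^-1).

Let p_gt0 : 0 < p. Proof. exact: lt_le_trans pp0. Qed.
Let K_ge1 : 1 <= K.
Proof. apply: (@le_trans _ _ (1 `^ p0^-1)); first by rewrite powR1.
by apply: ge0_ler_powR; rewrite ?nnegrE ?invr_ge0 ?(ltW p00)//; lra. Qed.
Let K0 : 0 <= K. Proof. exact: le_trans K_ge1. Qed.
Let rootK a : 1 <= a -> a <= 16 -> a `^ p^-1 <= K.
Proof. exact: root_le_bound. Qed.
Let rootVK a : 1 <= a -> a <= 16 -> (expR (- p) / a)^-1 `^ p^-1 <= expR 1 * K.
Proof.
move=> a1 a16; rewrite expR_root//; last exact: lt_le_trans a1.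
by rewrite ler_wpM2l ?expR_ge0// rootK.
Qed.
Let em1 : expR (- p) <= 1.
Proof. by rewrite -expR0 ler_expR oppr_le0 ltW. Qed.
Let e0 : 0 < expR (- p). Proof. exact: expR_gt0. Qed.

Let tail_event z0 z1 y : measurable [set w | y < max_dist z0 z1 X w].
Proof. by apply: measurable_tail_set; exact: measurable_max_dist. Qed.

Lemma start_dist_le_quantile z0 z1 u l :
  rearrangement P (max_dist z0 z1 X) (expR (- p) / 4) = u%:E ->
  unit_moment_root (ell P z0 X) p = l%:E ->
  [/\ 0 <= u, 0 <= l & mdist z1 z0 <= u + K * l].
Proof.
move=> Eu El; have u0 : 0 <= u by rewrite -lee_fin -Eu; exact: rearrangement_ge0.
have [l0 _] := unit_moment_rootE mX p_gt0 El.
have Pu : (P [set w | (u < max_dist z0 z1 X w)%R] <= (expR (- p) / 4)%:E)%E.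
  by apply: rearrangement_tail; [exact: measurable_max_dist|rewrite Eu].
have h2 : 0 < (1 / 2 : R) <= 1 by apply/andP; split; lra.
have [|y [Ey y0 yl]] := ell_quantile mX (C := K) p_gt0 h2 El.
  by rewrite invf_div divr1 rootK//; lra.
split => //; apply: (@le_trans _ _ (u + y)); last by rewrite lerD2l.
by apply: (start_dist_le n0 sG mX u0 _ Pu Ey); have := em1; lra.
Qed.

(** The level [v = u + K l] dominates both the quantile [u] and the starting
    distance, as [moment_max_dist_le] requires. *)
Lemma moment_root_le z0 z1 u l :
  rearrangement P (max_dist z0 z1 X) (expR (- p) / 4) = u%:E ->
  unit_moment_root (ell P z0 X) p = l%:E ->
  (moment_root P (max_dist z0 z1 X) p <= (16 * K * (K + 1) * (u + l))%:E)%E.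
Proof.
move=> Eu El; have [u0 l0 mul] := start_dist_le_quantile Eu El.
have [_ Il] := unit_moment_rootE mX p_gt0 El.
set v := u + K * l in mul.
have uv : u <= v by rewrite lerDl mulr_ge0.
have v0 : 0 <= v by exact: le_trans uv.
have Pv : (P [set w | (v < max_dist z0 z1 X w)%R] <= (expR (- p) / 4)%:E)%E.
  apply: rearrangement_tail; first exact: measurable_max_dist.
  by rewrite Eu lee_fin.
have := moment_max_dist_le sG mX iX p_gt0 mul Pv; rewrite Il => H.
rewrite moment_rootE.
have vp : v `^ p <= (v + l) `^ p.
  by apply: ge0_ler_powR; rewrite ?nnegrE ?(ltW p_gt0)//; lra.
have lp : l `^ p <= (v + l) `^ p.
  by apply: ge0_ler_powR; rewrite ?nnegrE ?(ltW p_gt0)//; lra.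
have {}H : (\int[P]_w (max_dist z0 z1 X w `^ p)%:E <= (10 * (16 * (v + l)) `^ p)%:E)%E.
  apply: (le_trans H); rewrite lee_fin.
  rewrite powRM//; last by lra.
  have : 0 <= (16 : R) `^ p by exact: powR_ge0.
  set A := 16 `^ p; move: vp lp; set B := (v + l) `^ p; set C := l `^ p; set D := v `^ p.
  move=> vp lp A0; rewrite -subr_ge0.
  have -> : 10 * (A * B) - 2 * A * (D + 4 * C) =
      2 * (A * (B - D)) + 8 * (A * (B - C)) by ring.
  by rewrite addr_ge0// mulr_ge0// mulr_ge0// subr_ge0.
apply: (@le_trans _ _ ((10 * (16 * (v + l)) `^ p)%:E `^ p^-1)%E).
  apply: gt0_ler_poweR; rewrite ?invr_ge0 ?(ltW p_gt0)// ?in_itv/= ?leey ?andbT//.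
    by apply: integral_ge0 => w _; rewrite lee_fin powR_ge0.
  by rewrite lee_fin mulr_ge0// powR_ge0.
rewrite poweR_EFin lee_fin powRM ?powR_ge0// powRK ?gt_eqF//; last by lra.
apply: (@le_trans _ _ (K * (16 * (v + l)))).
  apply: ler_wpM2r; first by lra.
  by apply: rootK; lra.
have -> : K * (16 * (v + l)) = 16 * K * (u + (K + 1) * l) by rewrite /v; ring.
rewrite -[leRHS]mulrA ler_wpM2l ?mulr_ge0//.
by rewrite mulrDr lerD2r ler_peMl//; have := K0; lra.
Qed.

Lemma rearrangement_le_moment_root z0 z1 m :
  moment_root P (max_dist z0 z1 X) p = m%:E ->
  (rearrangement P (max_dist z0 z1 X) (expR (- p) / 4) <= (expR 1 * K * m)%:E)%E.
Proof.
rewrite moment_rootE => Em; have mU : measurable_fun setT (max_dist z0 z1 X).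
  exact: measurable_max_dist.
have U0 := max_dist_ge0 z0 z1 X.
have m0 : 0 <= m by rewrite -lee_fin -Em; exact: poweR_ge0.
have Im : (\int[P]_w (max_dist z0 z1 X w `^ p)%:E = (m `^ p)%:E)%E.
  rewrite -poweR_EFin -Em -poweRrM mulVf ?gt_eqF// poweRe1//.
  by apply: integral_ge0 => w _; rewrite lee_fin powR_ge0.
rewrite /rearrangement ge_max lee_fin !mulr_ge0 ?expR_ge0//=.
apply: ge_ereal_sup => _ [y [y0 ty] <-]; rewrite lee_fin; have eg := e0.
have t0 : 0 < expR (- p) / 4 by rewrite divr_gt0.
apply: (le_root_mul p_gt0 t0) => //; first by apply: rootVK; lra.
rewrite -lee_fin -Im mulrC EFinM.
apply: le_trans (markov_moment P mU U0 p_gt0 y0).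
by apply: lee_wpmul2l; [rewrite lee_fin powR_ge0|exact: ltW].
Qed.

Lemma ell_le_moment_root z m :
  moment_root P (max_dist z z X) p = m%:E ->
  (unit_moment_root (ell P z X) p <= (2 * K * m)%:E)%E.
Proof.
rewrite moment_rootE => Em; have mU : measurable_fun setT (max_dist z z X).
  exact: measurable_max_dist.
have U0 := max_dist_ge0 z z X.
have m0 : 0 <= m by rewrite -lee_fin -Em; exact: poweR_ge0.
have Im : (\int[P]_w (max_dist z z X w `^ p)%:E = (m `^ p)%:E)%E.
  rewrite -poweR_EFin -Em -poweRrM mulVf ?gt_eqF// poweRe1//.
  by apply: integral_ge0 => w _; rewrite lee_fin powR_ge0.
have m2U : measurable_fun setT (fun w => (2 * max_dist z z X w)%:E).
  by apply/measurable_EFinP; exact: measurable_funM.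
have U20 w : (0 <= (2 * max_dist z z X w)%:E)%E by rewrite lee_fin mulr_ge0.
have := @moment_le_of_tails R _ _ _ _ _ _ leb P P (ell P z X)
  (fun w => (2 * max_dist z z X w)%:E) (fun w => (2 * max_dist z z X w)%:E)
  p 0 2 0 p_gt0 (lexx _) (ler0n _ _) (lexx _) (measurable_ell P mX z) m2U m2U
  (ell_ge0 P mX z) U20 U20 (fun y y0 => ell_tail_le1 P mX z y0).
have H y : 0 <= y -> (leb [set t | (y%:E < ell P z X t)%E] <=
    2%:E * P [set w | (y%:E < (2 * max_dist z z X w)%:E)%E] +
    0%:E * P [set w | (y%:E < (2 * max_dist z z X w)%:E)%E])%E.
  move=> y0; rewrite mul0e adde0.
  apply: (le_trans (ell_tail_le_max_step mX iX z y0)).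
  apply: lee_wpmul2l => //; apply: le_measure; rewrite ?inE.
  - by apply: measurable_tail_set; exact: measurable_max_step.
  - under eq_set do rewrite lte_fin.
    by apply: measurable_tail_set; exact: measurable_funM.
  by move=> w /= yM; rewrite lte_fin; apply: lt_le_trans yM _; exact: max_step_le2.
move=> /(_ H); rewrite mul0e adde0 powR0 ?gt_eqF// add0e.
under [X in (_ <= _ * X)%E]eq_integral do rewrite poweR_EFin powRM// EFinM.
rewrite ge0_integralZl//; last 2 first.
- by apply/measurable_EFinP; exact: (measurableT_comp (measurable_powR p)).
- by move=> w _; rewrite lee_fin powR_ge0.
rewrite Im -!EFinM -powRM// => {}H.
rewrite /unit_moment_root ell_moment//.
apply: (@le_trans _ _ ((2 * (2 * m) `^ p)%:E `^ p^-1)%E).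
  apply: gt0_ler_poweR; rewrite ?invr_ge0 ?(ltW p_gt0)// ?in_itv/= ?leey ?andbT//.
    by apply: integral_ge0 => w _; exact: poweR_ge0.
  by rewrite lee_fin mulr_ge0// powR_ge0.
rewrite poweR_EFin lee_fin powRM ?powR_ge0// powRK ?gt_eqF//; last by rewrite mulr_ge0.
rewrite mulrCA -mulrA ler_wpM2l// ler_wpM2r//; apply: rootK; lra.
Qed.

Let prob_max_step_trunc y l : 0 <= y -> y <= l ->
  P [set w | l < max_step (fun i w => truncation y%:E (X i w)) w] = 0%E.
Proof.
move=> y0 yl; rewrite (_ : [set _ | _] = set0) ?measure0//.
apply/seteqP; split => // w /=; rewrite ltNge => /negP; apply.
by apply: le_trans yl; exact: max_step_truncation.
Qed.

(** The truncated walk has no step above [y = ell(r)], so above [y] the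
    Hoffmann-Jorgensen inequality for it is [P (U' > 4b) <= P (U' > b)^2]. The
    room is used as [1/16 + 1/8 <= 1/4]. *)
Lemma rearrangement_le_trunc z u l :
  rearrangement P (max_dist_trunc P z X (expR (- p) / 8)) (expR (- p) / 4) = u%:E ->
  unit_moment_root (ell P z X) p = l%:E ->
  (rearrangement P (max_dist z z X) (expR (- p) / 4) <=
    (4 * (u + expR 1 * K * l))%:E)%E.
Proof.
rewrite max_dist_truncE => Eu El.
have u0 : 0 <= u by rewrite -lee_fin -Eu; exact: rearrangement_ge0.
have e1 := em1; have eg := e0.
have r01 : 0 < expR (- p) / 8 <= 1 by apply/andP; split; lra.
have [|y [Ey y0 yl]] := ell_quantile mX (C := expR 1 * K) p_gt0 r01 El.
  by apply: rootVK; lra.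
rewrite Ey in Eu.
pose X' := fun i w => truncation y%:E (X i w).
have mX' : forall i, borel_measurable (X' i) by exact: borel_measurable_truncation.
have iX' : mutually_independent P X' by exact: mutually_independent_truncation.
have mU' : measurable_fun setT (max_dist 1%g 1%g X') by exact: measurable_max_dist.
set b := u + y; have b0 : 0 <= b by rewrite addr_ge0.
have Pb : (P [set w | (b < max_dist 1%g 1%g X' w)%R] <= (expR (- p) / 4)%:E)%E.
  by apply: rearrangement_tail => //; rewrite Eu lee_fin lerDl.
have HJ := @hoffmann_jorgensen _ _ _ P _ _ X' sG mX' iX' 1%g 1%g b.
rewrite mdistxx prob_max_step_trunc ?lerDr// adde0 in HJ.
have {}HJ := HJ b0.
have HM := tail_max_step_ell mX (t := expR (- p) / 8) _ Ey.
have {}HM : (P [set w | (y < max_step X w)%R] <= (expR (- p) / 8)%:E)%E.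
  by apply: HM; case/andP: r01 => /ltW-> ->.
rewrite max_dist_base1.
apply: (@le_trans _ _ (4 * b)%:E); last by rewrite lee_fin ler_wpM2l// lerD2l.
apply: rearrangement_le; [exact: measurable_max_dist|by rewrite mulr_ge0|].
apply: (@le_trans _ _ (P ([set w | 4 * b < max_dist 1%g 1%g X' w] `|`
    [set w | y < max_step X w]))).
  apply: le_measure; rewrite ?inE//.
    apply: measurableU; first exact: measurable_tail_set.
    by apply: measurable_tail_set; exact: measurable_max_step.
  move=> w /= bU; have [yM|My] := ltP y (max_step X w); [by right|left].
  by rewrite max_dist_truncation.
apply: (le_trans (measureU2 _ _ _)).
- exact: measurable_tail_set.
- by apply: measurable_tail_set; exact: measurable_max_step.
apply: (@le_trans _ _ ((expR (- p) / 4) * (expR (- p) / 4) + expR (- p) / 8)%:E).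
  rewrite EFinD leeD//; apply: (le_trans HJ).
  by rewrite EFinM; apply: lee_pmul.
by rewrite lee_fin; nra.
Qed.

(** Here the inequality is applied to the original walk started at [1], whose
    steps are controlled at the smaller probability [exp(-p) / 16], and the
    room is used as [1/16 + 1/16 + 1/8 = 1/4]. *)
Lemma trunc_le_rearrangement z0 z1 u l :
  rearrangement P (max_dist z0 z1 X) (expR (- p) / 4) = u%:E ->
  unit_moment_root (ell P z0 X) p = l%:E ->
  (rearrangement P (max_dist_trunc P z0 X (expR (- p) / 8)) (expR (- p) / 4) <=
    (4 * (2 * u + (K + expR 1 * K) * l))%:E)%E.
Proof.
move=> Eu El; have [u0 l0 mul] := start_dist_le_quantile Eu El.
have e1 := em1; have eg := e0.
have r01 : 0 < expR (- p) / 8 <= 1 by apply/andP; split; lra.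
have [|y [Ey y0 yl]] := ell_quantile mX (C := expR 1 * K) p_gt0 r01 El.
  by apply: rootVK; lra.
have r01' : 0 < expR (- p) / 16 <= 1 by apply/andP; split; lra.
have [|y' [Ey' y'0 y'l]] := ell_quantile mX (C := expR 1 * K) p_gt0 r01' El.
  by apply: rootVK; lra.
rewrite max_dist_truncE Ey.
pose X' := fun i w => truncation y%:E (X i w).
have mX' : forall i, borel_measurable (X' i) by exact: borel_measurable_truncation.
have mU' : measurable_fun setT (max_dist 1%g 1%g X') by exact: measurable_max_dist.
(* Rebasing the walk at z0 costs m <= u + K l, which is added to the quantile u. *)
set b := 2 * u + K * l + y'.
have b0 : 0 <= b by rewrite !addr_ge0// mulr_ge0.
have Pb : (P [set w | (b < max_dist 1%g 1%g X w)%R] <= (expR (- p) / 4)%:E)%E.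
  apply: (@le_trans _ _ (P [set w | (u < max_dist z0 z1 X w)%R])); last first.
    by apply: rearrangement_tail; [exact: measurable_max_dist|rewrite Eu].
  apply: le_measure; rewrite ?inE// => w /=.
  have := max_dist_le_start X z0 z1 w; rewrite max_dist_base1 /b; lra.
have HJ := @hoffmann_jorgensen _ _ _ P _ _ X sG mX iX 1%g 1%g b.
rewrite mdistxx in HJ; have {}HJ := HJ b0.
have HM : (P [set w | (y < max_step X w)%R] <= (expR (- p) / 8)%:E)%E.
  by apply: (tail_max_step_ell mX _ Ey); case/andP: r01 => /ltW-> ->.
have HM' : (P [set w | (b < max_step X w)%R] <= (expR (- p) / 16)%:E)%E.
  apply: (@le_trans _ _ (P [set w | (y' < max_step X w)%R])); last first.
    by apply: (tail_max_step_ell mX _ Ey'); case/andP: r01' => /ltW-> ->.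
  apply: le_measure; rewrite ?inE;
    do ?by apply: measurable_tail_set; exact: measurable_max_step.
  move=> w /=; apply: le_lt_trans; rewrite lerDr addr_ge0// mulr_ge0//.
apply: (@le_trans _ _ (4 * b)%:E); last first.
  by rewrite lee_fin /b; lra.
apply: rearrangement_le => //; first by rewrite mulr_ge0.
apply: (@le_trans _ _ (P ([set w | 4 * b < max_dist 1%g 1%g X w] `|`
    [set w | y < max_step X w]))).
  apply: le_measure; rewrite ?inE//.
  - exact: measurable_tail_set.
  - apply: measurableU; first exact: tail_event.
    by apply: measurable_tail_set; exact: measurable_max_step.
  move=> w /= bU; have [yM|My] := ltP y (max_step X w); [by right|left].
  by rewrite -(max_dist_truncation _ _ My).
apply: (le_trans (measureU2 _ _ _)) => //.
  by apply: measurable_tail_set; exact: measurable_max_step.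
apply: (@le_trans _ _ ((expR (- p) / 4) * (expR (- p) / 4) + expR (- p) / 16
   + expR (- p) / 8)%:E).
  rewrite EFinD leeD//; apply: (le_trans HJ).
  by rewrite EFinD leeD// EFinM; apply: lee_pmul.
by rewrite lee_fin; nra.
Qed.

End four_inequalities.

(* The premise [z0 = z1] guards exactly the two inequalities that fail in
   general: over (R, +) with n = 1, z0 = 0, z1 = 1, the constant X_1 = 1 gives
   EU = 0 < 1 <= Q, and the constant X_1 = 0 gives Q' = 0 < 1 <= Q. *)
Theorem theorem3p6 (R : realType) (p0 : R) (hp0 : 0 < p0) :
  exists c1 c2 c3 c4 : R, [/\ 0 < c1, 0 < c2, 0 < c3 & 0 < c4] /\
  forall (p : R) (G : metricMonoidType R)
    (d : measure_display) (Omega : measurableType d) (P : probability Omega R)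
    (n : nat) (X : 'I_n -> Omega -> G) (z0 z1 : G),
    p0 <= p ->
    commutative (fun a b : G => (a * b)%g) ->
    separable G ->
    (0 < n)%N ->
    (forall i, borel_measurable (X i)) ->
    mutually_independent P X ->
    let EU := moment_root P (max_dist z0 z1 X) p in
    let Q := (rearrangement P (max_dist z0 z1 X) (expR (- p) / 4) +
              unit_moment_root (ell P z0 X) p)%E in
    let Q' := (rearrangement P (max_dist_trunc P z0 X (expR (- p) / 8))
                 (expR (- p) / 4) +
               unit_moment_root (ell P z0 X) p)%E in
    [/\ (c1^-1%:E * EU <= Q)%E,
        z0 = z1 -> (Q <= c2%:E * EU)%E,
        z0 = z1 -> (c3^-1%:E * Q <= Q')%E
      & (Q' <= c4%:E * Q)%E].
Proof.
pose K : R := 16 `^ p0^-1; pose e : R := expR 1.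
have K0 : 0 < K by exact: powR_gt0.
have e0 : 0 < e by exact: expR_gt0.
have eK0 : 0 < e * K by exact: mulr_gt0.
have c1_gt0 : 0 < 16 * K * (K + 1) by rewrite !mulr_gt0// addr_gt0.
have c2_gt0 : 0 < e * K + 2 * K by lra.
have c3_gt0 : 0 < 4 * (e * K) + 4 by lra.
have c4_gt0 : 0 < 8 + 4 * (K + e * K) by lra.
exists (16 * K * (K + 1)), (e * K + 2 * K), (4 * (e * K) + 4), (8 + 4 * (K + e * K)).
split; first by split.
move=> p G d Omega P n X z0 z1 pp0 _ sG n0 mX iX EU Q Q'.
have L0 : (0 <= unit_moment_root (ell P z0 X) p)%E by exact: poweR_ge0.
have EU0 : (0 <= EU)%E by exact: poweR_ge0.
have ru0 := rearrangement_ge0 P (max_dist z0 z1 X) (expR (- p) / 4).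
have ru'0 := rearrangement_ge0 P (max_dist_trunc P z0 X (expR (- p) / 8)) (expR (- p) / 4).
split.
- rewrite /Q; move: L0 ru0.
  case El : (unit_moment_root _ _) => [l| |] // _; last first.
    by move=> r0; rewrite addey ?leey// -ltNye (lt_le_trans _ r0).
  case Eu : (rearrangement _ _ _) => [u| |] // _; last by rewrite leey.
  have H := moment_root_le n0 sG mX iX hp0 pp0 Eu El.
  apply: (@le_trans _ _ ((16 * K * (K + 1))^-1%:E * (16 * K * (K + 1) * (u + l))%:E)%E).
    by apply: lee_wpmul2l H; rewrite lee_fin invr_ge0 ltW.
  by rewrite -EFinM mulKf ?gt_eqF.
- move=> z01; subst z1; rewrite /Q; case Em : EU EU0 => [m| |] // m0; last first.
    by rewrite gt0_muley ?lte_fin// leey.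
  have H1 := rearrangement_le_moment_root sG mX hp0 pp0 Em.
  have H2 := ell_le_moment_root sG mX iX hp0 pp0 Em.
  by rewrite -EFinM mulrDl EFinD; exact: leeD.
- move=> z01; rewrite /Q /Q' -z01; move: L0 ru'0.
  case El : (unit_moment_root _ _) => [l| |] // l0; last first.
    by move=> r0; rewrite [leRHS]addey ?leey// -ltNye (lt_le_trans _ r0).
  case Eu : (rearrangement _ (max_dist_trunc _ _ _ _) _) => [u| |] // u0; last by rewrite leey.
  have H := rearrangement_le_trunc sG mX iX hp0 pp0 Eu El.
  apply: (@le_trans _ _ ((4 * (e * K) + 4)^-1%:E * (4 * (u + e * K * l) + l)%:E)%E).
    apply: lee_wpmul2l; first by rewrite lee_fin invr_ge0 ltW.
    by rewrite EFinD leeD2r.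
  rewrite -EFinM -EFinD lee_fin ler_pdivrMl//.
  rewrite !lee_fin in l0 u0; nra.
- rewrite /Q /Q'; move: L0 ru0.
  case El : (unit_moment_root _ _) => [l| |] // l0.
    case Eu : (rearrangement _ (max_dist _ _ _) _) => [u| |] // u0; last first.
      by rewrite addye// gt0_muley ?lte_fin// leey.
    have H := trunc_le_rearrangement n0 sG mX iX hp0 pp0 Eu El.
    apply: (@le_trans _ _ (4 * (2 * u + (K + e * K) * l) + l)%:E).
      by rewrite EFinD leeD2r.
    rewrite !lee_fin in l0 u0 *; nra.
  move=> u0; rewrite [X in (_ <= _ * X)%E]addey; last by rewrite -ltNye (lt_le_trans _ u0).
  by rewrite gt0_muley ?lte_fin// leey.
Qed.
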